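(* Let $p,q,r\in[0,1]$ with $p+q+r=1$ and $0<r<1$, let $s\in[0,1]$, and let $(S_n)$ be the elephant random walk with stops (ERWS) with parameters $p,q,r,s$. Assume the superdiffusive regime $\frac{p}{1-r}>\frac34$. Then $$\lim_{n\to\infty}\frac{S_n}{n^{2p+r-1}}=L\qquad\text{almost surely},$$ where $L$ is a non-degenerate random variable. Moreover, this convergence holds in $\mathbb{L}^m$ for every integer $m\ge1$, which means that for every integer $m\ge1$, $$\lim_{n\to\infty}\mathbb{E}\left[\left|\frac{S_n}{n^{2p+r-1}}-L\right|^m\right]=0.$$
   Context: The elephant random walk with stops (ERWS) is defined as follows. The parameters are $p,q,r\in[0,1]$ with $p+q+r=1$, where $0<r<1$ is assumed throughout, and $s\in[0,1]$. The first step $X_1$ equals $+1$ with probability $s$ and $-1$ with probability $1-s$. For each $n\ge 1$, given $X_1,\dots,X_n$, an integer $k$ is chosen uniformly at random in $\{1,\dots,n\}$ and, independently of this choice and of the past, $X_{n+1}=X_k$ with probability $p$, $X_{n+1}=-X_k$ with probability $q$, and $X_{n+1}=0$ with probability $r$. The position of the ERWS is $S_0=0$ and $S_n=\sum_{k=1}^n X_k$ for $n\ge1$. Non-degenerate means not almost surely equal to a constant. *)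

(* Defs.v *)
From HB Require Import structures.
From mathcomp Require Import all_boot all_order all_algebra.
From mathcomp Require Import all_classical all_reals all_analysis.
Set Implicit Arguments.
Unset Strict Implicit.
Unset Printing Implicit Defensive.
Import Order.TTheory GRing.Theory Num.Theory.
Import numFieldNormedType.Exports.
Local Open Scope classical_set_scope.
Local Open Scope ring_scope.

(* Steps are indexed from 1: the value X 0 is never used. *)
Definition history_event (T : Type) (R : realType) (X : nat -> T -> R)
    (n : nat) (x : nat -> R) : set T :=
  [set w | forall i, (1 <= i <= n)%N -> X i w = x i].

(* X n : the n-th step; K n : the index drawn in {1, ..., n} at time n;
   A n : what is done with the recalled step, namely repeat it (A n = 1),
   reverse it (A n = -1) or stop (A n = 0).  The past (X 1, ..., X n), K n and
   A n are discrete, so their independence is the product rule on atoms;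
   nothing is required jointly with K i and A i for i < n. *)
Record is_erws (d : measure_display) (T : measurableType d) (R : realType)
    (P : probability T R) (p q r s : R)
    (X : nat -> {RV P >-> R}) (K : nat -> {RV P >-> nat})
    (A : nat -> {RV P >-> R}) : Prop := IsERWS {
  erws_first_pos : P [set w | X 1%N w = 1] = s%:E ;
  erws_first_neg : P [set w | X 1%N w = -1] = (1 - s)%:E ;
  erws_index : forall n k : nat, (1 <= k <= n)%N ->
    P [set w | K n w = k] = (n%:R^-1)%:E ;
  erws_repeat : forall n, (1 <= n)%N -> P [set w | A n w = 1] = p%:E ;
  erws_reverse : forall n, (1 <= n)%N -> P [set w | A n w = -1] = q%:E ;
  erws_stop : forall n, (1 <= n)%N -> P [set w | A n w = 0] = r%:E ;
  erws_indep : forall (n : nat) (x : nat -> R) (k : nat) (a : R), (1 <= n)%N ->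
    P (history_event X n x `&` [set w | K n w = k] `&` [set w | A n w = a]) =
    (P (history_event X n x) * P [set w | K n w = k] *
       P [set w | A n w = a])%E ;
  erws_step : forall n, (1 <= n)%N ->
    {ae P, forall w, X n.+1 w = A n w * X (K n w) w}
}.

Definition position (T : Type) (R : realType) (X : nat -> T -> R)
    (n : nat) (w : T) : R := \sum_(1 <= k < n.+1) X k w.

Definition non_degenerate (d : measure_display) (T : measurableType d)
    (R : realType) (P : probability T R) (Y : T -> R) : Prop :=
  ~ exists c : R, {ae P, forall w, Y w = c}.

(* Main.v *)
From HB Require Import structures.
Require Import Defs.
From mathcomp Require Import all_boot all_order all_algebra.
From mathcomp Require Import all_classical all_reals all_analysis.
From mathcomp Require Import measurable_realfun.
From mathcomp Require Import ring lra.
Set Implicit Arguments.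
Unset Strict Implicit.
Unset Printing Implicit Defensive.
Import Order.TTheory GRing.Theory Num.Theory.
Import numFieldNormedType.Exports.
Local Open Scope classical_set_scope.
Local Open Scope ring_scope.

(** Put alpha = p - q = 2 p + r - 1 and beta = p + q = 1 - r.  Given the first n
    steps, the next step has conditional mean alpha S_n / n and conditional
    second moment beta Z_n / n, where Z_n counts the nonzero steps.  Hence
    M_n = S_n / b_n, with b_n the product of the 1 + alpha / j for 1 <= j < n,
    is a martingale, and b_n / n^alpha is nondecreasing and bounded, so it
    converges to some c >= 1.  As Z_n is of order n^beta and b_n of order
    n^alpha, the increments of M_n have squared norm of order n^(-1 - delta)
    with delta = 2 alpha - beta, and p / (1 - r) > 3 / 4 says exactly that
    delta > 0.

    All expectations are computed on finite histories: [expectation_mean] turns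
    the expectation of any function of the first n steps into the functional
    [mean], an iteration of one-step forecasts, and the forecast of a function
    depends on the past through S_n and Z_n only ([forecastE]).

    The core is the bound E (M_n - M_N)^(2k) <= C_k N^(- k delta), valid for
    every k and all n >= N ([mean_mart_diff_exp]).  It follows by a recursion on
    n: a second-order Taylor bound makes the linear term vanish by the
    martingale property, and the remaining term, of the form
    Z_n (M_n - M_N)^(2k - 2), is split into moments of Z_n and the quantity being
    bounded.  The moments of Z_n come for free because its rising factorials are
    eigenfunctions of the forecast ([mean_rising]).

    High moments then replace maximal inequalities.  Along n = 2^j the increments
    of M_n are summable in mean, so M converges almost surely along these times
    to some L0; Fatou's lemma transfers the bound to
    E (L0 - M_N)^(2k); with k delta >= 2 these are summable in N, which forces
    the whole sequence M_N to converge to L0 ([ae_cvg_of_rate]).  The same rates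
    give convergence in every L^m, and S_n / n^alpha tends to L = c L0.

    If L were constant, E (M_n - a)^2 would tend to 0 for some constant a.  But
    this quantity is nondecreasing in n, and at n = 2 it is at least the
    conditional variance (beta - alpha^2) / b_2^2 of the second step, which is
    positive because alpha^2 <= beta^2 < beta ([mean_mart_sqr_ge]). *)

(** * Elementary inequalities *)

(** Induction on the exponent: multiply the bound for the power m + 2 by x + d;
    Pascal's rule makes the constant a binomial coefficient. *)
Lemma expr_taylor2 (R : realDomainType) (m : nat) (x d : R) :
  `|(x + d) ^+ m.+2 - x ^+ m.+2 - m.+2%:R * x ^+ m.+1 * d|
    <= 'C(m.+2, 2)%:R * d ^+ 2 * (`|x| + `|d|) ^+ m.
Proof.
elim: m => [|m IH].
  rewrite (_ : (x + d) ^+ 2 - _ - _ = d ^+ 2); last by ring.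
  by rewrite ger0_norm ?sqr_ge0// expr0 mulr1 mul1r.
rewrite (_ : (x + d) ^+ m.+3 - _ - _ =
    (x + d) * ((x + d) ^+ m.+2 - x ^+ m.+2 - m.+2%:R * x ^+ m.+1 * d)
    + m.+2%:R * x ^+ m.+1 * d ^+ 2); last first.
  by rewrite -(natr1 m.+2) !exprS; ring.
apply: (le_trans (ler_normD _ _)).
rewrite binS bin1 natrD -[leRHS]mulrA [leRHS]mulrDl lerD//.
  rewrite normrM [leRHS](_ : _ = (`|x| + `|d|) *
      ('C(m.+2, 2)%:R * d ^+ 2 * (`|x| + `|d|) ^+ m)); last first.
    by rewrite [(_ + `|d|) ^+ m.+1]exprS; ring.
  by rewrite ler_pM// ler_normD.
rewrite !normrM normr_nat normrX -(normrM d d) (ger0_norm (sqr_ge0 d)) -mulrA ler_wpM2l//.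
rewrite mulrC ler_wpM2l ?sqr_ge0//.
by rewrite lerXn2r ?nnegrE ?addr_ge0// lerDl.
Qed.

(** The larger of u and v ^ 2 dominates both factors.  Used to decouple the
    number of moves from the martingale. *)
Lemma mulr_exp_le_add (R : realDomainType) (k : nat) (u v : R) :
  0 <= u -> 0 <= v ->
  u * v ^+ (k.*2) <= u ^+ k.+1 + v ^+ (k.+1).*2.
Proof.
move=> u0 v0; rewrite -!mul2n !exprM; set y := v ^+ 2.
have y0 : 0 <= y by rewrite sqr_ge0.
have [uy|/ltW yu] := leP u y.
  apply: (@le_trans _ _ (y ^+ k.+1)); last by rewrite lerDr exprn_ge0.
  by rewrite exprS ler_wpM2r ?exprn_ge0.
apply: (@le_trans _ _ (u ^+ k.+1)); last by rewrite lerDl exprn_ge0.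
by rewrite exprS ler_wpM2l// lerXn2r.
Qed.

Lemma exprD_le_max (R : realDomainType) (m : nat) (a b : R) :
  0 <= a -> 0 <= b -> (a + b) ^+ m <= 2 ^+ m * (a ^+ m + b ^+ m).
Proof.
wlog ab : a b / a <= b => [H a0 b0|a0 b0].
  by have [/H|/ltW /H] := leP a b; [|rewrite addrC [X in _ * X]addrC]; apply.
apply: (@le_trans _ _ ((2 * b) ^+ m)).
  by rewrite lerXn2r ?nnegrE ?addr_ge0 ?mulr_ge0//; lra.
by rewrite exprMn ler_wpM2l ?exprn_ge0// lerDr exprn_ge0.
Qed.

Section products.
Context {R : realType}.
Implicit Types (t : R) (n N : nat).

(** The factor by which forecasts multiply an eigenfunction with eigenvalue
    1 + t / j at time j; it is Gamma(n + t) / (Gamma(n) Gamma(1 + t)). *)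
Definition growth t n : R := \prod_(1 <= j < n) (1 + t / j%:R).

Lemma growth1 t : growth t 1 = 1.
Proof. by rewrite /growth big_geq. Qed.

Lemma growthS t n : (0 < n)%N -> growth t n.+1 = growth t n * (1 + t / n%:R).
Proof. by move=> n0; rewrite /growth big_nat_recr. Qed.

Lemma growth_ge1 t n : 0 <= t -> 1 <= growth t n.
Proof.
move=> t0; rewrite /growth; elim/big_rec: _ => // j x _ x1.
apply: (le_trans x1); rewrite ler_peMl ?(le_trans _ x1)//.
by rewrite lerDl divr_ge0.
Qed.

Lemma growth_gt0 t n : 0 <= t -> 0 < growth t n.
Proof. by move=> t0; rewrite (lt_le_trans ltr01) ?growth_ge1. Qed.

(** This is ln (1 + 1/n) >= 1/(n+1), in a form that avoids logarithms. *)
Lemma natS_expR n : (0 < n)%N -> n%:R * expR (n.+1%:R^-1) <= n.+1%:R :> R.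
Proof.
move=> n0; have nS : (0 : R) < n.+1%:R by [].
have := expR_ge1Dx (- (n.+1%:R^-1 : R)); rewrite expRN => h.
have e0 := expR_gt0 (n.+1%:R^-1 : R).
rewrite -ler_pdivlMr//.
apply: (le_trans _ (ler_wpM2l (ltW nS) h)).
by rewrite mulrDr mulr1 mulrN divff ?gt_eqF// -natr1; lra.
Qed.

(** From 1 + t/n <= exp (t/n) and exp (1/(n+1)) <= 1 + 1/n, the quotient of
    both sides telescopes like the sum of t/n - t/(n+1). *)
Lemma growth_le t n : 0 <= t -> (0 < n)%N ->
  growth t n <= expR t * n%:R `^ t.
Proof.
move=> t0 n0.
suff H : growth t n <= expR (t - t / n%:R) * n%:R `^ t.
  apply: (le_trans H); rewrite ler_wpM2r ?powR_ge0// ler_expR.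
  by rewrite gerBl divr_ge0.
case: n n0 => // n _; elim: n => [|n IH].
  by rewrite growth1 divr1 subrr expR0 mul1r powR1.
rewrite growthS//.
apply: (@le_trans _ _ (expR (t - t / n.+1%:R) * n.+1%:R `^ t * expR (t / n.+1%:R))).
  apply: ler_pM; [exact/ltW/growth_gt0|by rewrite addr_ge0// divr_ge0|exact: IH|].
  exact: expR_ge1Dx.
rewrite mulrAC -expRD subrK.
rewrite expRB -mulrA ler_wpM2l ?expR_ge0// mulrC ler_pdivlMr ?expR_gt0//.
rewrite mulrC [t / _]mulrC expRM -powRM ?expR_ge0// mulrC.
by rewrite ge0_ler_powR ?nnegrE ?mulr_ge0 ?expR_ge0// natS_expR.
Qed.

(** With u = ln (1 + x), combine 1 + y <= exp y at y = u - u t and y = - u t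
    with weights t and 1 - t: the linear terms cancel. *)
Lemma bernoulli_powR t x : 0 <= t <= 1 -> 0 <= x -> (1 + x) `^ t <= 1 + t * x.
Proof.
move=> /andP[t0 t1] x0; have x1 : 0 < 1 + x by lra.
set u := ln (1 + x); have ux : expR u = 1 + x by rewrite lnK// posrE.
rewrite -ux -expRM.
have h1 := expR_ge1Dx (u - u * t); have h2 := expR_ge1Dx (- (u * t)).
have h3 : expR (u - u * t) * expR (u * t) = expR u by rewrite -expRD subrK.
have h4 : expR (- (u * t)) * expR (u * t) = 1 by rewrite -expRD addNr expR0.
have h5 := expR_gt0 (u * t).
have h6 : 1 <= t * expR (u - u * t) + (1 - t) * expR (- (u * t)) by nra.
have : expR (u * t) <=
    (t * expR (u - u * t) + (1 - t) * expR (- (u * t))) * expR (u * t).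
  by rewrite ler_peMl// ltW.
by rewrite [leRHS]mulrDl -!mulrA h3 h4 ux; lra.
Qed.

Lemma growth_ratio_nondecreasing t n : 0 <= t <= 1 -> (0 < n)%N ->
  growth t n / n%:R `^ t <= growth t n.+1 / n.+1%:R `^ t.
Proof.
move=> t01 n0; have /andP[t0 t1] := t01.
have p0 : (0 : R) < n%:R by rewrite ltr0n.
rewrite ler_pdivlMr ?powR_gt0// mulrAC ler_pdivrMr ?powR_gt0//.
rewrite growthS// -mulrA ler_wpM2l ?(ltW (growth_gt0 _ _))//.
rewrite (_ : n.+1%:R = (1 + n%:R^-1) * n%:R); last first.
  by rewrite mulrDl mul1r mulVf ?gt_eqF// -natr1 addrC.
rewrite powRM// ler_wpM2r ?powR_ge0//.
by rewrite bernoulli_powR ?invr_ge0.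
Qed.

Lemma growth_ratio_ge1 t n : 0 <= t <= 1 -> (0 < n)%N -> 1 <= growth t n / n%:R `^ t.
Proof.
move=> t01; elim: n => // -[_ _|n IH _].
  by rewrite growth1 powR1 divr1.
by apply: (le_trans (IH _)) => //; exact: growth_ratio_nondecreasing.
Qed.

Lemma powR_le_growth t n : 0 <= t <= 1 -> (0 < n)%N -> n%:R `^ t <= growth t n.
Proof.
move=> t01 n0; have := growth_ratio_ge1 t01 n0.
by rewrite ler_pdivlMr ?mul1r// powR_gt0// ltr0n.
Qed.

Lemma growth_ratio_cvg t : 0 <= t <= 1 ->
  exists2 c : R, 1 <= c & growth t n / n%:R `^ t @[n --> \oo] --> c.
Proof.
move=> t01; have /andP[t0 t1] := t01.
pose u n := growth t n.+1 / n.+1%:R `^ t.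
have nd : nondecreasing_seq u.
  by apply/nondecreasing_seqP => n; exact: growth_ratio_nondecreasing.
have ub : has_ubound (range u).
  exists (expR t) => _ [n _ <-]; rewrite /u.
  by rewrite ler_pdivrMr ?powR_gt0// growth_le.
have cu := nondecreasing_is_cvgn nd ub.
exists (limn u); last by rewrite -cvg_shiftS; exact: cu.
apply: (le_trans _ (nondecreasing_cvgn_le nd cu 0)).
by rewrite /u growth_ratio_ge1.
Qed.

(** Discrete counterpart of the derivative of x^(-e): (1 + 1/n)^e is at least
    1 + e/(n+1). *)
Lemma powR_telescope (e : R) n : 0 < e -> (0 < n)%N ->
  n%:R `^ (- 1 - e) <= (2 + e) / e * (n%:R `^ (- e) - n.+1%:R `^ (- e)).
Proof.
move=> e0 n0; have p0 : (0 : R) < n%:R by rewrite ltr0n.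
have p1 : (1 : R) <= n%:R by rewrite ler1n.
have nS : (0 : R) < n.+1%:R by [].
have h : n.+1%:R `^ (- e) <= n%:R `^ (- e) / (1 + e / n.+1%:R).
  rewrite ler_pdivlMr ?addr_gt0 ?divr_gt0// !powRN.
  rewrite ler_pdivrMl ?powR_gt0// ler_pdivlMr ?powR_gt0//.
  apply: (@le_trans _ _ (expR (e / n.+1%:R) * n%:R `^ e)).
    by rewrite ler_wpM2r ?powR_ge0// expR_ge1Dx.
  rewrite [e / _]mulrC expRM -powRM ?expR_ge0//.
  rewrite ge0_ler_powR ?nnegrE ?mulr_ge0 ?expR_ge0 ?(ltW e0)//.
  by rewrite mulrC natS_expR.
rewrite powRB; last by rewrite (gt_eqF p0) implybT.
rewrite (_ : n%:R `^ (-1) = n%:R^-1); last by rewrite powR_inv1.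
rewrite [X in _ <= X]mulrC -ler_pdivrMr ?divr_gt0 ?addr_gt0//.
rewrite -powRN.
set y := n%:R `^ (- e) in h *; have y0 : 0 <= y by apply: powR_ge0.
apply: (@le_trans _ _ (y - y / (1 + e / n.+1%:R))); last by rewrite lerD2l lerN2.
rewrite (_ : y - _ = y * (e / (n.+1%:R + e))); last first.
by field; apply/andP; split; rewrite gt_eqF//; lra.
rewrite [_ * y]mulrC -mulrA ler_wpM2l// invf_div mulrCA.
rewrite ler_wpM2l ?(ltW e0)//.
rewrite -invfM lef_pV2 ?posrE ?mulr_gt0 ?addr_gt0//.
by rewrite -natr1; nra.
Qed.

Lemma sum_powR_le (e : R) N n : 0 < e -> (0 < N)%N -> (N <= n)%N ->
  \sum_(N <= j < n) j%:R `^ (- 1 - e) <= (2 + e) / e * N%:R `^ (- e).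
Proof.
move=> e0 N0 Nn.
apply: (@le_trans _ _ ((2 + e) / e * (N%:R `^ (- e) - n%:R `^ (- e)))).
  rewrite -[X in _ * X]opprB -(telescope_sumr (fun j => j%:R `^ (- e)) Nn).
  rewrite -sumrN mulr_sumr !big_nat ler_sum// => j /andP[Nj _].
  by rewrite opprB powR_telescope// (leq_trans N0).
rewrite ler_wpM2l ?gerBl ?powR_ge0//.
by rewrite divr_ge0 ?addr_ge0 ?ltW.
Qed.

End products.

Lemma powRN_cvg0 (R : realType) (e : R) : 0 < e -> n%:R `^ (- e) @[n --> \oo] --> (0 : R).
Proof.
move=> e0; apply/cvgrPdist_lt => eps eps0.
near=> n; have n0 : (0 : R) < n%:R by rewrite ltr0n; near: n; exists 1%N.
rewrite sub0r normrN ger0_norm ?powR_ge0// powRN -[X in _ < X]invrK.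
rewrite ltf_pV2 ?posrE ?powR_gt0 ?invr_gt0//.
rewrite -[X in X < _]powRr1 ?invr_ge0 ?(ltW eps0)//.
rewrite -[X in _ `^ X < _](mulVf (x := e)) ?gt_eqF// powRrM.
apply: gt0_ltr_powR => //; rewrite ?nnegrE ?powR_ge0//.
rewrite (lt_le_trans (archi_boundP (powR_ge0 _ _)))// ler_nat.
by near: n; exact: nbhs_infty_ge.
Unshelve. all: by end_near. Qed.

(** * Moments of the walk on finite histories *)

Section model.
Context {R : realType} (p q r s : R).
Implicit Types (x : seq R) (G H : seq R -> R) (n N k : nat).

Definition is_step (y : R) : bool := y \in [:: 1; -1; 0].

(** Histories list the latest step first, so that a new step is a [cons]. *)
Definition is_history n x : bool := (size x == n) && all is_step x.

(** Conditional expectation, given the history x, of G at the next history. *)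
Definition forecast G x : R := (size x)%:R^-1 *
  \sum_(y <- x) (p * G (y :: x) + q * G (- y :: x) + r * G (0 :: x)).

(** The expectation of G over histories of length n, by the tower property: G is
    forecast back step by step down to the law of the first step.  The value at
    0 is a placeholder. *)
Fixpoint mean n G : R :=
  if n is m.+1 then
    if m is 0 then s * G [:: 1] + (1 - s) * G [:: -1] else mean m (forecast G)
  else 0.

Definition pos x : R := \sum_(y <- x) y.
(** Steps are 1, -1 or 0, so this is the number of nonzero ones. *)
Definition moves x : R := \sum_(y <- x) y ^+ 2.

Let alpha := p - q.
Let beta := p + q.
Let delta := 2 * alpha - beta.

Lemma meanS n G : (0 < n)%N -> mean n.+1 G = mean n (forecast G).
Proof. by case: n. Qed.

Lemma is_step_opp y : is_step y -> is_step (- y).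
Proof. by rewrite /is_step !inE => /or3P[] /eqP ->; rewrite ?opprK ?oppr0 eqxx ?orbT. Qed.

Lemma is_step0 : is_step 0.
Proof. by rewrite /is_step !inE eqxx !orbT. Qed.

Lemma is_step1 : is_step 1.
Proof. by rewrite /is_step !inE eqxx. Qed.

Lemma is_history_cons n y x : is_history n x -> is_step y -> is_history n.+1 (y :: x).
Proof. by move=> /andP[/eqP <- xs] ys; rewrite /is_history/= eqxx ys. Qed.

Lemma forecast_lin a G H x :
  forecast (fun z => a * G z + H z) x = a * forecast G x + forecast H x.
Proof.
rewrite /forecast mulrCA -mulrDr; congr (_ * _); rewrite mulr_sumr -big_split/=.
by apply: eq_bigr => y _; ring.
Qed.

Lemma mean_ext n G H : G =1 H -> mean n G = mean n H.
Proof. by move=> /funext ->. Qed.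

Lemma mean_lin n a G H :
  mean n (fun z => a * G z + H z) = a * mean n G + mean n H.
Proof.
elim: n G H => [|[|n] IH] G H; [by rewrite /=; ring|by rewrite /=; ring|].
by rewrite !(@meanS n.+1)// -IH; apply: mean_ext => x; rewrite forecast_lin.
Qed.

Lemma mean0 n : mean n (fun=> 0) = 0.
Proof.
have := mean_lin n 1 (fun=> 0) (fun=> 0).
by rewrite (@mean_ext _ (fun=> _) (fun=> 0)) => [|x]; [lra|rewrite mulr0 addr0].
Qed.

Lemma meanZ n a G : mean n (fun z => a * G z) = a * mean n G.
Proof.
have := mean_lin n a G (fun=> 0); rewrite mean0 addr0 => <-.
by apply: mean_ext => x; rewrite addr0.
Qed.

Lemma meanD n G H : mean n (fun z => G z + H z) = mean n G + mean n H.
Proof.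
rewrite -[mean n G]mul1r -mean_lin.
by apply: mean_ext => x; rewrite mul1r.
Qed.

Hypotheses (hp : 0 <= p <= 1) (hq : 0 <= q <= 1) (hr : 0 < r < 1)
  (hpqr : p + q + r = 1) (hs : 0 <= s <= 1).

Let p0 : 0 <= p. Proof. by case/andP: hp. Qed.
Let q0 : 0 <= q. Proof. by case/andP: hq. Qed.
Let r0 : 0 <= r. Proof. by case/andP: hr => /ltW. Qed.
Let beta01 : 0 < beta < 1.
Proof.
by case/andP: hr => ? ?; move: hpqr; rewrite /beta => ?; apply/andP; split; lra.
Qed.
Let beta0 : 0 <= beta. Proof. by case/andP: beta01 => /ltW. Qed.

Lemma forecast_le G H x : all is_step x ->
  (forall y, is_step y -> G (y :: x) <= H (y :: x)) ->
  forecast G x <= forecast H x.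
Proof.
move=> xs GH; rewrite /forecast ler_wpM2l ?invr_ge0//.
rewrite !big_seq ler_sum// => y yx; have ys := allP xs _ yx.
by rewrite !lerD// ler_wpM2l// GH// ?is_step_opp// is_step0.
Qed.

Lemma mean_le n G H : (forall x, is_history n x -> G x <= H x) ->
  mean n G <= mean n H.
Proof.
elim: n G H => [//|[|n] IH] G H GH.
  have s0 : 0 <= s by case/andP: hs.
  have s1 : 0 <= 1 - s by rewrite subr_ge0; case/andP: hs.
  by rewrite lerD// ler_wpM2l// GH// /is_history/= ?is_step1 ?is_step_opp ?is_step1.
apply: IH => x /[dup] xh /andP[_ xs]; apply: forecast_le => // y ys.
by apply: GH; exact: is_history_cons.
Qed.

Lemma mean_eq n G H : (forall x, is_history n x -> G x = H x) ->
  mean n G = mean n H.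
Proof.
move=> GH; apply/eqP; rewrite eq_le !mean_le// => x xh; rewrite GH//.
Qed.

Lemma mean_cst n a : (0 < n)%N -> mean n (fun=> a) = a.
Proof.
elim: n => // -[|n] IH _; first by rewrite /mean; ring.
rewrite meanS// -[RHS]IH//; apply: mean_eq => x /andP[/eqP sx _].
rewrite /forecast big_const_seq count_predT iter_addr_0 sx.
rewrite -!mulrDl hpqr mul1r -[a *+ _]mulr_natl mulrA mulVf ?mul1r//.
Qed.

(** On steps 1, -1 and 0 every function agrees with a polynomial of degree 2,
    so only the sums of the steps and of their squares matter. *)
Lemma forecastE n G x : is_history n x -> (0 < n)%N ->
  forecast G x = G (0 :: x) + alpha * pos x / n%:R * ((G (1 :: x) - G (-1 :: x)) / 2)
    + beta * moves x / n%:R * ((G (1 :: x) + G (-1 :: x)) / 2 - G (0 :: x)).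
Proof.
move=> /andP[/eqP sx xs] n0; have n0' : n%:R != 0 :> R by rewrite pnatr_eq0 -lt0n.
set g0 := G (0 :: x); set g1 := G (1 :: x); set gN := G (-1 :: x).
transitivity (n%:R^-1 * (\sum_(y <- x) (g0 + (alpha * ((g1 - gN) / 2)) * y
   + (beta * ((g1 + gN) / 2 - g0)) * y ^+ 2))).
  rewrite /forecast sx; congr (_ * _); rewrite !big_seq; apply: eq_bigr => y yx.
  have := allP xs _ yx; rewrite /is_step !inE -/g0 => /or3P[] /eqP ->;
    rewrite ?opprK ?oppr0 -/g0 -/g1 -/gN /alpha /beta.
  - have -> : r = 1 - p - q by rewrite -hpqr; ring.
    by field.
  - have -> : r = 1 - p - q by rewrite -hpqr; ring.
    by field.
  - have -> : r = 1 - p - q by rewrite -hpqr; ring.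
    by field.
rewrite !big_split/= -!mulr_sumr -/(pos x) -/(moves x).
rewrite big_const_seq count_predT iter_addr_0 sx -[g0 *+ n]mulr_natl.
by field.
Qed.

Lemma pos_cons y x : pos (y :: x) = y + pos x. Proof. exact: big_cons. Qed.
Lemma moves_cons y x : moves (y :: x) = y ^+ 2 + moves x. Proof. exact: big_cons. Qed.

Lemma moves_ge0 x : 0 <= moves x.
Proof. by apply: sumr_ge0 => y _; exact: sqr_ge0. Qed.

Lemma norm_is_step y : is_step y -> `|y| <= 1.
Proof. by rewrite /is_step !inE => /or3P[] /eqP ->; rewrite ?normrN ?normr1 ?normr0. Qed.

Lemma norm_pos_le n x : is_history n x -> `|pos x| <= n%:R.
Proof.
move=> /andP[/eqP <-]; elim: x => [|y x IH] /=; first by rewrite /pos big_nil normr0.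
move=> /andP[ys xs]; rewrite pos_cons -natr1 addrC.
by rewrite (le_trans (ler_normD _ _))// lerD// ?IH// norm_is_step.
Qed.

Definition rising k (z : R) : R := \prod_(i < k) (z + i%:R).

(** Both sides are z (z + 1) ... (z + k). *)
Lemma rising_shift k z : z * rising k (z + 1) = (z + k%:R) * rising k z.
Proof.
have -> : z * rising k (z + 1) = rising k.+1 z.
  rewrite /rising big_ord_recl addr0; congr (_ * _).
  by apply: eq_bigr => i _; rewrite lift0 -natr1; ring.
by rewrite /rising big_ord_recr/= mulrC.
Qed.

Lemma expr_le_rising k (z : R) : 0 <= z -> z ^+ k <= rising k z.
Proof.
move=> z0; elim: k => [|k IH]; first by rewrite /rising big_ord0.
rewrite exprSr /rising big_ord_recr/= ler_pM ?exprn_ge0//.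
by rewrite lerDl.
Qed.

Lemma rising1 k : rising k 1 = k`!%:R.
Proof.
elim: k => [|k IH]; first by rewrite /rising big_ord0.
by rewrite /rising big_ord_recr/= -/(rising k 1) IH factS natrM mulrC nat1r.
Qed.

(** By [rising_shift], a rising factorial of order k is multiplied by
    1 + k beta / n in the forecast at time n. *)
Lemma mean_rising n k : (0 < n)%N ->
  mean n (rising k \o moves) = k`!%:R * growth (k%:R * beta) n.
Proof.
elim: n => // -[_ _|n IH _].
  rewrite growth1 mulr1 /= !moves_cons /moves !big_nil !addr0 sqrrN expr1n rising1.
  by ring.
rewrite meanS// growthS// mulrA -IH//.
rewrite [RHS]mulrC -meanZ; apply: mean_eq => x xh.
rewrite (forecastE _ xh)//= !moves_cons sqrrN expr1n expr0n/= add0r addrC.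
have := rising_shift k (moves x); rewrite [moves x + 1]addrC => h.
rewrite (_ : beta * moves x / _ * _ = beta / n.+1%:R *
   (moves x * rising k (1 + moves x) - moves x * rising k (moves x))).
  by rewrite h; ring.
by field; rewrite nat1r pnatr_eq0.
Qed.

Lemma mean_moves_expr_le n k : (0 < n)%N ->
  mean n (fun x => moves x ^+ k) <=
    k`!%:R * expR (k%:R * beta) * (n%:R `^ beta) ^+ k.
Proof.
move=> n0; apply: (@le_trans _ _ (mean n (rising k \o moves))).
  by apply: mean_le => x _; rewrite expr_le_rising// moves_ge0.
rewrite mean_rising// -mulrA ler_wpM2l//.
have -> : (n%:R `^ beta) ^+ k = n%:R `^ (k%:R * beta).
  by rewrite mulrC powRrM powR_mulrn// powR_ge0.
by rewrite growth_le// mulr_ge0.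
Qed.

(** The martingale S_n / b_n of the walk, as a function of the history. *)
Definition mart x : R := pos x / growth alpha (size x).

(** The latest step comes first, so dropping size x - N entries leaves the
    history at time N. *)
Definition mart_diff N x : R := mart x - mart (drop (size x - N) x).

Hypothesis alpha0 : 0 <= alpha.

Let alpha1 : alpha <= 1.
Proof. by case/andP: hr => ? ?; move: hpqr q0; rewrite /alpha => ? ?; lra. Qed.

Let growth_alpha_gt0 n : 0 < growth alpha n. Proof. exact: growth_gt0. Qed.

Lemma mart_cons n x y : is_history n x -> (0 < n)%N ->
  mart (y :: x) = mart x + (y - alpha * pos x / n%:R) / growth alpha n.+1.
Proof.
move=> /andP[/eqP sx _] n0; rewrite /mart /= sx pos_cons growthS//.
have ? : growth alpha n != 0 by rewrite gt_eqF.
have ? : n%:R != 0 :> R by rewrite pnatr_eq0 -lt0n.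
have ? : (n%:R + alpha) != 0 by rewrite gt_eqF// ltr_wpDr// ltr0n.
by field; apply/and3P; split.
Qed.

Lemma mart_diff_cons n N x y : is_history n x -> (0 < n)%N -> (N <= n)%N ->
  mart_diff N (y :: x) = mart_diff N x + (y - alpha * pos x / n%:R) / growth alpha n.+1.
Proof.
move=> xh n0 Nn; rewrite /mart_diff (mart_cons _ xh)//.
by case/andP: (xh) => /eqP sx _; rewrite /= sx subSn//=; ring.
Qed.

(** Taylor expansion around the present value: the first-order term has forecast
    0, and the conditional variance of the step is at most its conditional
    second moment. *)
Lemma forecast_mart_diff_exp n N k x :
  is_history n x -> (0 < n)%N -> (N <= n)%N ->
  forecast (fun z => mart_diff N z ^+ k.+2) x <= mart_diff N x ^+ k.+2 +
    'C(k.+2, 2)%:R * (beta * moves x / n%:R / growth alpha n.+1 ^+ 2)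
      * (`|mart_diff N x| + 2 / growth alpha n.+1) ^+ k.
Proof.
move=> xh n0 Nn; set D := mart_diff N x; set b := growth alpha n.+1.
have b0 : 0 < b by exact: growth_gt0.
have n0' : (0 : R) < n%:R by rewrite ltr0n.
set a := alpha * pos x / n%:R; set F := (`|D| + 2 / b) ^+ k.
have F0 : 0 <= F by rewrite exprn_ge0// addr_ge0// divr_ge0// ltW.
have a1 : `|a| <= 1.
  rewrite /a normrM normfV normr_nat ler_pdivrMr// mul1r normrM (ger0_norm alpha0).
  by apply: (le_trans _ (norm_pos_le xh)); rewrite ler_piMl.
(* The majorant depends on the next history only through its latest step. *)
pose Y z : R := head 0 z.
pose H z := D ^+ k.+2 + k.+2%:R * D ^+ k.+1 * ((Y z - a) / b)
   + 'C(k.+2, 2)%:R * ((Y z - a) / b) ^+ 2 * F.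
apply: (@le_trans _ _ (forecast H x)).
  case/andP: (xh) => _ xs; apply: forecast_le => // y ys.
  rewrite (mart_diff_cons _ xh)// -/D -/a -/b /H /Y/=.
  set e := (y - a) / b.
  have eb : `|e| <= 2 / b.
    rewrite /e normrM normfV (gtr0_norm b0) ler_pM2r ?invr_gt0//.
    by rewrite (le_trans (ler_normB _ _))//; have := norm_is_step ys; lra.
  rewrite -lerBlDl opprD addrA (le_trans (ler_norm _))//.
  apply: (le_trans (expr_taylor2 _ _ _)); rewrite ler_wpM2l//.
    by rewrite mulr_ge0// sqr_ge0.
  by rewrite lerXn2r ?nnegrE ?addr_ge0// ?lerD2l// divr_ge0// ltW.
rewrite (forecastE _ xh)// /H /Y/= -!/a.
have -> : beta * moves x / n%:R = (beta * moves x / n%:R - a ^+ 2) + a ^+ 2 by ring.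
set v := _ - a ^+ 2.
have -> : D ^+ k.+2 + k.+2%:R * D ^+ k.+1 * ((0 - a) / b) +
    'C(k.+2, 2)%:R * ((0 - a) / b) ^+ 2 * F +
  a * ((D ^+ k.+2 + k.+2%:R * D ^+ k.+1 * ((1 - a) / b) +
     'C(k.+2, 2)%:R * ((1 - a) / b) ^+ 2 * F -
    (D ^+ k.+2 + k.+2%:R * D ^+ k.+1 * ((- 1 - a) / b) +
     'C(k.+2, 2)%:R * ((- 1 - a) / b) ^+ 2 * F)) / 2) +
  (v + a ^+ 2) * ((D ^+ k.+2 + k.+2%:R * D ^+ k.+1 * ((1 - a) / b) +
     'C(k.+2, 2)%:R * ((1 - a) / b) ^+ 2 * F +
    (D ^+ k.+2 + k.+2%:R * D ^+ k.+1 * ((- 1 - a) / b) +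
     'C(k.+2, 2)%:R * ((- 1 - a) / b) ^+ 2 * F)) / 2 -
    (D ^+ k.+2 + k.+2%:R * D ^+ k.+1 * ((0 - a) / b) +
    'C(k.+2, 2)%:R * ((0 - a) / b) ^+ 2 * F)) =
  D ^+ k.+2 + 'C(k.+2, 2)%:R * (v / b ^+ 2) * F.
  by field; rewrite gt_eqF.
rewrite lerD2l ler_wpM2r// ler_wpM2l// ler_wpM2r ?invr_ge0 ?sqr_ge0//.
by rewrite lerDl sqr_ge0.
Qed.


Hypothesis delta0 : 0 < delta.

(** The previous bound, normalized by h = N^(- delta / 2), the expected size of
    the difference, and by the order n^beta of the number of moves; after
    [mulr_exp_le_add] both normalized quantities appear separately. *)
Lemma forecast_mart_diff_rate n N k x (h := N%:R `^ (- (delta / 2))) :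
  is_history n x -> (0 < N)%N -> (N <= n)%N ->
  forecast (fun z => mart_diff N z ^+ (k.+1).*2) x <=
    mart_diff N x ^+ (k.+1).*2 +
    'C((k.+1).*2, 2)%:R * beta * n%:R `^ (- 1 - delta) * h ^+ (k.*2) *
    ((moves x / n%:R `^ beta) ^+ k.+1 + 2 ^+ (k.+1).*2 *
      (mart_diff N x ^+ (k.+1).*2 / h ^+ (k.+1).*2 + 2 ^+ (k.+1).*2)).
Proof.
move=> xh N0 Nn; have n0 : (0 < n)%N by exact: leq_trans Nn.
have n0' : (0 : R) < n%:R by rewrite ltr0n.
have N0' : (0 : R) < N%:R by rewrite ltr0n.
have h0 : 0 < h by rewrite powR_gt0.
set D := mart_diff N x; set b := growth alpha n.+1.
have b0 : 0 < b by exact: growth_gt0.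
have bn : n%:R `^ alpha <= b.
  apply: (@le_trans _ _ (n.+1%:R `^ alpha)).
    by rewrite ge0_ler_powR ?nnegrE// ler_nat.
  by rewrite powR_le_growth// alpha0 alpha1.
(* One increment has scale 1 / b, at most h because delta / 2 <= alpha. *)
have bVh : b^-1 <= h.
  rewrite /h powRN lef_pV2 ?posrE ?powR_gt0// (le_trans _ bn)//.
  apply: (@le_trans _ _ (n%:R `^ (delta / 2))).
    by rewrite ge0_ler_powR ?nnegrE// ?ler_nat// divr_ge0// ltW.
  rewrite ler_powR// ?ler1n//.
  by rewrite /delta; move: beta0 => ?; lra.
set U := moves x / n%:R `^ beta; set V := `|D| / h + 2.
have U0 : 0 <= U by rewrite divr_ge0 ?moves_ge0 ?powR_ge0.
have V0 : 0 <= V by rewrite addr_ge0// divr_ge0// ltW.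
apply: (le_trans (forecast_mart_diff_exp _ xh n0 Nn)); rewrite -/D -/b.
rewrite lerD2l -!mulrA ler_wpM2l// !mulrA -/(k.*2).
have E1 : beta * moves x / n%:R / b ^+ 2 <= beta * n%:R `^ (- 1 - delta) * U.
  rewrite (_ : n%:R `^ (- 1 - delta) = n%:R^-1 * n%:R `^ beta / (n%:R `^ alpha) ^+ 2); last first.
    rewrite -powR_mulrn ?powR_ge0// -powRrM -powR_inv1// -powRN -!powRD; first last.
    - by rewrite (gt_eqF n0') implybT.
    - by rewrite (gt_eqF n0') implybT.
    by congr (_ `^ _); rewrite /delta; ring.
  have nb : n%:R `^ beta != 0 by rewrite gt_eqF// powR_gt0.
  have na : n%:R `^ alpha != 0 by rewrite gt_eqF// powR_gt0.
  rewrite (_ : _ * U = beta * moves x / n%:R / (n%:R `^ alpha) ^+ 2); last first.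
    by rewrite /U; field; rewrite nb na gt_eqF.
  rewrite ler_wpM2l ?divr_ge0 ?mulr_ge0 ?moves_ge0//.
  by rewrite lef_pV2 ?posrE ?exprn_gt0 ?powR_gt0// lerXn2r ?nnegrE ?powR_ge0// ltW.
have E2 : (`|D| + 2 / b) ^+ k.*2 <= h ^+ k.*2 * V ^+ k.*2.
  rewrite -exprMn lerXn2r ?nnegrE ?addr_ge0 ?mulr_ge0 ?invr_ge0 ?(ltW b0) ?(ltW h0)//.
  by rewrite /V mulrDr mulrCA divff ?gt_eqF// mulr1 lerD2l mulrC ler_wpM2r.
have E3 : U * V ^+ k.*2 <= U ^+ k.+1 + V ^+ (k.+1).*2 by exact: mulr_exp_le_add.
have E4 : V ^+ (k.+1).*2 <= 2 ^+ (k.+1).*2 *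
      (D ^+ (k.+1).*2 / h ^+ (k.+1).*2 + 2 ^+ (k.+1).*2).
  apply: (le_trans (exprD_le_max _ _ _)); rewrite ?divr_ge0 ?(ltW h0)//.
  rewrite ler_wpM2l ?exprn_ge0// lerD2r expr_div_n -[D ^+ _]ger0_norm ?normrX//.
  by rewrite exprn_even_ge0// odd_double.
apply: (@le_trans _ _ (beta * n%:R `^ (- 1 - delta) * U * (h ^+ k.*2 * V ^+ k.*2))).
  apply: ler_pM => //; last first.
    by rewrite exprn_ge0// addr_ge0// divr_ge0// ltW.
  by rewrite divr_ge0 ?sqr_ge0// divr_ge0// mulr_ge0 ?moves_ge0.
rewrite (_ : _ * U * _ = beta * n%:R `^ (-1 - delta) * h ^+ k.*2 * (U * V ^+ k.*2)); last by ring.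
rewrite ler_wpM2l ?mulr_ge0 ?powR_ge0 ?exprn_ge0// ?(ltW h0)//.
by rewrite (le_trans E3)// lerD2l.
Qed.

Lemma mart_diff_same N x : size x = N -> mart_diff N x = 0.
Proof. by move=> xN; rewrite /mart_diff xN subnn drop0 subrr. Qed.

(** Writing w n for the moment divided by its target h^m, the forecast bound reads
    1 + w (n+1) <= (1 + w n) (1 + Q N^delta n^(-1-delta)), starting from w N = 0.
    The sum of the n^(-1-delta) over n >= N is of order N^(-delta), so w stays
    bounded uniformly in n and N. *)
Lemma mean_mart_diff_exp k : exists2 C : R, 0 <= C & forall N n, (0 < N)%N -> (N <= n)%N ->
  mean n (fun x => mart_diff N x ^+ (k.+1).*2) <= C * (N%:R `^ (- delta)) ^+ k.+1.
Proof.
set m := (k.+1).*2.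
(* c bounds the moment of the number of moves divided by n^beta; the summand
   2^m * 2^m absorbs the additive constants of the forecast bound. *)
pose c : R := (k.+1)`!%:R * expR (k.+1%:R * beta).
have c0 : 0 <= c by rewrite mulr_ge0// expR_ge0.
pose Q1 : R := 'C(m, 2)%:R * beta; have Q10 : 0 <= Q1 by rewrite mulr_ge0.
pose Q := Q1 * (c + 2 ^+ m * 2 ^+ m).
have Q0 : 0 <= Q by rewrite mulr_ge0// addr_ge0// mulr_ge0// exprn_ge0.
exists (expR (Q * ((2 + delta) / delta))); first exact: expR_ge0.
move=> N n N0 Nn; have N0' : (0 : R) < N%:R by rewrite ltr0n.
pose h : R := N%:R `^ (- (delta / 2)); have h0 : 0 < h by rewrite powR_gt0.
have h2 : h ^+ 2 = N%:R `^ (- delta).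
  by rewrite -powR_mulrn ?powR_ge0// -powRrM; congr (_ `^ _); field.
have hm : (N%:R `^ (- delta)) ^+ k.+1 = h ^+ m by rewrite -h2 -exprM mul2n.
pose w n := mean n (fun x => mart_diff N x ^+ m) / h ^+ m.
have hm0 : 0 < h ^+ m by rewrite exprn_gt0.
rewrite hm -ler_pdivrMr// -/(w n).
have w0 i : 0 <= w i.
  rewrite divr_ge0 ?(ltW hm0)// -(mean0 i) mean_le// => x _.
  by rewrite exprn_even_ge0// odd_double.
suff H : 1 + w n <= expR (Q * (N%:R `^ delta * \sum_(N <= j < n) j%:R `^ (- 1 - delta))).
  apply: (@le_trans _ _ (1 + w n)); first by rewrite lerDr.
  rewrite (le_trans H)// ler_expR ler_wpM2l//.
  have := sum_powR_le delta0 N0 Nn; rewrite powRN => /(ler_wpM2l (powR_ge0 N%:R delta)).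
  by move/le_trans; apply; rewrite mulrCA divff ?mulr1// gt_eqF// powR_gt0.
elim: n Nn => [|n IH]; first by rewrite leqn0 => /eqP N0''; rewrite N0'' in N0.
rewrite leq_eqVlt ltnS => /predU1P[Nn|Nn].
  rewrite Nn big_geq// mulr0 mulr0 expR0 gerDl /w.
  rewrite (@mean_eq n.+1 _ (fun=> 0)) ?mean0 ?mul0r// => x /andP[/eqP sx _].
  by rewrite -Nn in sx; rewrite mart_diff_same// expr0n.
have n0 : (0 < n)%N by exact: leq_trans Nn.
have n0' : (0 : R) < n%:R by rewrite ltr0n.
rewrite big_nat_recr//= mulrDr mulrDr expRD.
apply: (@le_trans _ _ ((1 + w n) * (1 + Q * (N%:R `^ delta * n%:R `^ (- 1 - delta))))); last first.
  apply: ler_pM; [by rewrite addr_ge0| |exact: IH|exact: expR_ge1Dx].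
  by rewrite addr_ge0// mulr_ge0// mulr_ge0// powR_ge0.
suff : w n.+1 <= w n + Q * (N%:R `^ delta * n%:R `^ (- 1 - delta)) * (1 + w n) by lra.
rewrite {1}/w ler_pdivrMr// meanS//.
pose y : R := n%:R `^ (- 1 - delta).
have y0 : 0 <= y by exact: powR_ge0.
apply: (@le_trans _ _ (mean n (fun x => (Q1 * y * h ^+ k.*2) *
   (n%:R `^ beta ^- k.+1 * moves x ^+ k.+1 + 2 ^+ m * 2 ^+ m) +
   (1 + Q1 * y * h ^+ k.*2 * 2 ^+ m / h ^+ m) * mart_diff N x ^+ m))).
  apply: mean_le => x xh; apply: (le_trans (forecast_mart_diff_rate _ xh N0 Nn)).
  rewrite -/m -/h -/y -/Q1 expr_div_n le_eqVlt; apply/orP; left; apply/eqP.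
  by field; rewrite !expf_neq0 ?gt_eqF ?powR_gt0.
rewrite mean_lin meanZ meanD meanZ mean_cst//.
set u := mean n (fun x => mart_diff N x ^+ m).
have uw : u = w n * h ^+ m by rewrite /w divfK// gt_eqF.
have hk : h ^+ m = h ^+ k.*2 * h ^+ 2 by rewrite -exprD addn2.
have hd : N%:R `^ delta * h ^+ 2 = 1 by rewrite h2 powRN divff// gt_eqF// powR_gt0.
have cU : n%:R `^ beta ^- k.+1 * mean n (fun x => moves x ^+ k.+1) <= c.
  by rewrite ler_pdivrMl ?exprn_gt0 ?powR_gt0// mulrC mean_moves_expr_le.
apply: (@le_trans _ _ (Q1 * y * h ^+ k.*2 * (c + 2 ^+ m * 2 ^+ m) +
   (u + Q1 * y * h ^+ k.*2 * 2 ^+ m * w n))).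
  rewrite lerD ?ler_wpM2l ?lerD2r ?mulr_ge0 ?exprn_ge0 ?(ltW h0)//.
  rewrite uw le_eqVlt; apply/orP; left; apply/eqP.
  by field; rewrite !expf_neq0 ?gt_eqF.
rewrite mulrDl -uw addrCA lerD2l.
rewrite [leRHS](_ : _ = (Q1 * y * h ^+ k.*2) * (c + 2 ^+ m * 2 ^+ m) * (1 + w n)
   * (N%:R `^ delta * h ^+ 2)); last by rewrite hk /Q -/y; ring.
rewrite hd mulr1 [leRHS]mulrDr mulr1 lerD2l ler_wpM2r// ler_wpM2l//.
  by rewrite !mulr_ge0// exprn_ge0// ltW.
rewrite (@le_trans _ _ (2 ^+ m * 2 ^+ m))//; last by rewrite lerDr.
by rewrite ler_peMl ?exprn_ge0// exprn_ege1// ler1n.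
Qed.

(** Positivity of the conditional variance of the second step: alpha <= beta and
    0 < beta < 1. *)
Lemma drift_sqr_lt : alpha ^+ 2 < beta.
Proof.
have ab : alpha <= beta by rewrite /alpha /beta lerD2l ge0_cp.
case/andP: beta01 => b0 b1; apply: (@le_lt_trans _ _ (beta ^+ 2)).
  by rewrite lerXn2r// nnegrE.
by rewrite expr2 gtr_pMl.
Qed.

(** The mean square distance of a martingale to a constant is nondecreasing; at
    time 2 it contains the variance of the second step given the first, which
    is the same for both values of the first step. *)
Lemma mean_mart_sqr_ge n c : (2 <= n)%N ->
  (beta - alpha ^+ 2) / growth alpha 2 ^+ 2 <= mean n (fun x => (mart x - c) ^+ 2).
Proof.
have stp i x : (0 < i)%N -> is_history i x ->
    forecast (fun z => (mart z - c) ^+ 2) x = (mart x - c) ^+ 2 +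
      (beta * moves x / i%:R - (alpha * pos x / i%:R) ^+ 2) / growth alpha i.+1 ^+ 2.
  move=> i0 xh; rewrite (forecastE _ xh)// !(mart_cons _ xh)//.
  by field; rewrite !gt_eqF// ?ltr0n.
elim: n => // n IH; rewrite leq_eqVlt ltnS => /predU1P[[<-]|n2].
  set v := _ / _; have v0 : 0 <= v.
    by rewrite divr_ge0 ?sqr_ge0// subr_ge0 ltW// drift_sqr_lt.
  (* At time 1 only the histories [:: 1] and [:: -1] can have positive weight. *)
  have h1 y : y ^+ 2 = 1 -> is_step y ->
      v <= forecast (fun z => (mart z - c) ^+ 2) [:: y].
    move=> y1 ys; rewrite (stp 1)//; last by rewrite /is_history/= ys.
    rewrite pos_cons moves_cons /pos /moves !big_nil !divr1 !addr0 exprMn y1 !mulr1.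
    by rewrite lerDr sqr_ge0.
  rewrite meanS// /mean; case/andP: hs => s0 s1.
  have := h1 1 (expr1n _ _) is_step1.
  have := h1 (-1); rewrite sqrrN expr1n => /(_ erefl (is_step_opp is_step1)).
  by nra.
have n0 : (0 < n)%N by exact: leq_trans n2.
apply: (le_trans (IH n2)); rewrite meanS//.
apply: mean_le => x xh.
(* Minorant of the square that is affine in the next step, with zero drift. *)
pose H z := (mart x - c) ^+ 2 +
  2 * (mart x - c) * ((head 0 z - alpha * pos x / n%:R) / growth alpha n.+1).
rewrite (_ : (mart x - c) ^+ 2 = forecast H x); last first.
  rewrite (forecastE _ xh)// /H/=.
  by field; rewrite !gt_eqF// ?ltr0n.
case/andP: (xh) => _ xs; apply: forecast_le => // y ys.
rewrite /H (mart_cons _ xh)//=.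
set e := _ / growth alpha n.+1.
by rewrite -subr_ge0 [X in 0 <= X](_ : _ = e ^+ 2) ?sqr_ge0//; ring.
Qed.

End model.

(** * From the random walk to finite histories *)

Section finite_valued.
Context {d : measure_display} {T : measurableType d} {R : realType}.
Variable P : probability T R.

Lemma probability_EFin (B : set T) : measurable B -> P B = (fine (P B))%:E.
Proof. by move=> mB; rewrite fineK// fin_num_measure. Qed.

(** Turns laws given by point masses into almost sure statements. *)
Lemma ae_mem_of_sum (V : eqType) (f : T -> V) (l : seq V) : uniq l ->
  (forall v, measurable [set w | f w = v]) ->
  (\sum_(v <- l) P [set w | f w = v] = 1)%E ->
  {ae P, forall w, f w \in l}.
Proof.
move=> ul mf l1.
have [mU PU] : measurable [set w | f w \in l] /\
    P [set w | f w \in l] = (\sum_(v <- l) P [set w | f w = v])%E.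
  elim: l ul {l1} => [_|v l IH /= /andP[vl ul]].
    rewrite big_nil (_ : [set _ | _] = set0) ?measure0//.
    by apply/seteqP; split.
  have [mU PU] := IH ul.
  have -> : [set w | f w \in v :: l] = [set w | f w = v] `|` [set w | f w \in l].
    apply/seteqP; split => w /=; rewrite inE.
      by move=> /predU1P.
    by move=> H; apply/predU1P.
  split; first exact: measurableU.
  rewrite big_cons -PU measureU//; apply/seteqP; split => // w [/= -> H].
  by move: vl; rewrite H.
exists (~` [set w | f w \in l]); split => //; first exact: measurableC.
by rewrite probability_setC// PU; apply/eqP; rewrite l1 subee.
Qed.

Lemma measurable_simple (I : Type) (l : seq I) (c : I -> R) (B : I -> set T) :
  (forall i, measurable (B i)) ->
  measurable_fun setT (fun w => \sum_(i <- l) c i * \1_(B i) w).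
Proof.
move=> mB; apply: measurable_sum => i.
by apply: measurable_funM => //; exact: measurable_indic.
Qed.

(** A function of a finite history is almost surely a combination of indicators of
    events, which reduces its expectation to a finite sum. *)
Lemma expectation_ae_simple (I : Type) (l : seq I) (c : I -> R) (B : I -> set T)
    (f : T -> R) : measurable_fun setT f -> (forall i, measurable (B i)) ->
  {ae P, forall w, f w = \sum_(i <- l) c i * \1_(B i) w} ->
  ('E_P[f] = (\sum_(i <- l) c i * fine (P (B i)))%R%:E)%E.
Proof.
move=> mf mB fE; rewrite unlock.
have mS := @measurable_simple _ l c _ mB.
rewrite (ae_eq_integral (fun w => (\sum_(i <- l) c i * \1_(B i) w)%:E))//; first last.
- by apply: filterS fE => w /= -> _.
- exact/measurable_EFinP.
- exact/measurable_EFinP.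
under eq_integral do rewrite -sumEFin.
rewrite integral_sum//; last first.
  move=> i; under eq_fun do rewrite EFinM.
  by apply: integrableZl => //; exact: integrable_indic.
rewrite -sumEFin; apply: eq_bigr => i _.
under eq_integral do rewrite EFinM.
rewrite integralZl//; last exact: integrable_indic.
by rewrite integral_indic// setIT EFinM -probability_EFin.
Qed.

Lemma measure_ae_eq (A B : set T) : measurable A -> measurable B ->
  {ae P, forall w, A w <-> B w} -> P A = P B.
Proof.
move=> mA mB AB; rewrite -[A]setIT -[B]setIT -!integral_indic//.
apply: ae_eq_integral => //.
- by apply/measurable_EFinP; exact: measurable_indic.
- by apply/measurable_EFinP; exact: measurable_indic.
- apply: filterS AB => w AB _; rewrite !indicE.
  by rewrite (_ : (w \in A) = (w \in B))//; apply/idP/idP => /set_mem /AB /mem_set.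
Qed.

End finite_valued.

Section bridge.
Context {d : measure_display} {T : measurableType d} {R : realType}.
Context {P : probability T R} {p q r s : R}.
Context {X : nat -> {RV P >-> R}} {K : nat -> {RV P >-> nat}} {A : nat -> {RV P >-> R}}.
Hypotheses (hpqr : p + q + r = 1) (hX : is_erws p q r s X K A).

Lemma measurable_level (n : nat) (a : R) : measurable [set w | X n w = a].
Proof. exact: (@measurable_funPTI _ _ _ _ (X n) [set a]). Qed.

Lemma measurable_level_index (n k : nat) : measurable [set w | K n w = k].
Proof. exact: (@measurable_funPTI _ _ _ _ (K n) [set k]). Qed.

Lemma measurable_level_action (n : nat) (a : R) : measurable [set w | A n w = a].
Proof. exact: (@measurable_funPTI _ _ _ _ (A n) [set a]). Qed.

Lemma steps_uniq : uniq [:: 1; -1; 0 : R].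
Proof.
rewrite /= !inE oppr_eq0 oner_eq0 orbF andbT -subr_eq0 opprK.
by rewrite -[1 + 1]/(2%:R) pnatr_eq0.
Qed.

Lemma ae_action n : (0 < n)%N -> {ae P, forall w, is_step (A n w)}.
Proof.
move=> n0; apply: ae_mem_of_sum; [exact: steps_uniq|exact: measurable_level_action|].
rewrite !big_cons big_nil (erws_repeat hX)// (erws_reverse hX)// (erws_stop hX)//.
by rewrite adde0 -!EFinD addrA hpqr.
Qed.

Lemma ae_index n : (0 < n)%N -> {ae P, forall w, (K n w \in index_iota 1 n.+1)}.
Proof.
move=> n0; apply: ae_mem_of_sum; [exact: iota_uniq|exact: measurable_level_index|].
rewrite big_seq (eq_bigr (fun=> (n%:R^-1)%:E)); last first.
  by move=> k; rewrite mem_index_iota ltnS => kn; rewrite (erws_index hX).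
rewrite -big_seq sumEFin big_const_nat subn1 iter_addr_0 -[_ *+ _]mulr_natl divff//.
by rewrite pnatr_eq0 -lt0n.
Qed.

Lemma ae_first : {ae P, forall w, X 1%N w \in [:: 1; -1]}.
Proof.
apply: ae_mem_of_sum; last 1 first.
- rewrite !big_cons big_nil (erws_first_pos hX) (erws_first_neg hX).
  by rewrite adde0 -EFinD subrKC.
- by move: steps_uniq; rewrite /= !inE !negb_or andbT => /andP[/andP[->]].
- exact: measurable_level.
Qed.

(** Strong induction, since the step at time n + 1 recalls an earlier one. *)
Lemma ae_is_step n : (0 < n)%N -> {ae P, forall w, is_step (X n w)}.
Proof.
elim/ltn_ind: n => -[//|[_ _|n IH _]].
  apply: filterS ae_first => w; rewrite /is_step !inE.
  by move=> /orP[] ->; rewrite ?orbT.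
have H : {ae P, forall w, forall i, (0 < i <= n.+1)%N -> is_step (X i w)}.
  apply: ae_foralln => i; have [/andP[i0 iN]|_] := boolP (0 < i <= n.+1)%N.
    by apply: filterS (IH i _ i0) => // w.
  by apply: aeW.
apply: filterS3 H (erws_step hX (ltn0Sn n)) (filterI (ae_action (ltn0Sn n)) (ae_index (ltn0Sn n))).
move=> w Hi -> [Aw Kw]; move: Kw; rewrite mem_index_iota ltnS => /Hi.
by move: Aw; rewrite /is_step !inE => /or3P[] /eqP -> /or3P[] /eqP ->;
  rewrite ?(mul1r, mulN1r, mul0r, opprK, oppr0, eqxx, orbT).
Qed.

(** Equal to X n almost surely, but with values in {1, -1, 0} at every point of
    the space: functions of finitely many such steps are simple functions, and
    therefore measurable whatever they are. *)
Definition tstep n w : R := \1_[set w | X n w = 1] w - \1_[set w | X n w = -1] w.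

Lemma tstepE n w : is_step (X n w) -> tstep n w = X n w.
Proof.
have /= := steps_uniq; rewrite !inE !negb_or => /andP[/andP[h1 h2] /andP[h3 _]].
rewrite /is_step !inE /tstep !indicE => /or3P[] /eqP Xw.
- by rewrite mem_set// memNset /= ?Xw ?subr0//; apply/eqP.
- by rewrite memNset /= ?Xw// ?mem_set ?sub0r//; apply/eqP; rewrite eq_sym.
- by rewrite !memNset /= ?Xw ?subr0//; apply/eqP; rewrite eq_sym.
Qed.

Lemma tstep_is_step n w : is_step (tstep n w).
Proof.
rewrite /is_step !inE /tstep !indicE.
by do 2!case: (_ \in _); rewrite ?subrr ?subr0 ?sub0r eqxx ?orbT.
Qed.

Lemma measurable_tstep n : measurable_fun setT (tstep n).
Proof. by apply: measurable_funB; apply: measurable_indic; exact: measurable_level. Qed.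

Lemma ae_tstepE : {ae P, forall w, forall n, (0 < n)%N -> tstep n w = X n w}.
Proof.
apply: ae_foralln => -[|n]; first exact: aeW.
by apply: filterS (ae_is_step (ltn0Sn n)) => w /tstepE.
Qed.

Fixpoint hist n w : seq R := if n is m.+1 then tstep m.+1 w :: hist m w else [::].

Fixpoint histories n : seq (seq R) :=
  if n is m.+1 then [seq y :: x | y <- [:: 1; -1; 0], x <- histories m] else [:: [::]].

Lemma size_hist n w : size (hist n w) = n.
Proof. by elim: n => //= n ->. Qed.

Lemma hist_is_history n w : is_history n (hist n w).
Proof.
by rewrite /is_history size_hist eqxx; elim: n => //= n ->; rewrite tstep_is_step.
Qed.

Lemma mem_histories n x : (x \in histories n) = is_history n x.
Proof.
elim: n x => [|n IH] x; first by rewrite inE /is_history; case: x.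
apply/allpairsP/idP => [[[y z] /= [ys zh ->]]|].
  by apply: is_history_cons; rewrite ?IH in zh *.
case: x => // y x; rewrite /is_history /= eqSS andbCA => /andP[ys xh].
by exists (y, x); split=> //=; rewrite IH.
Qed.

Lemma histories_uniq n : uniq (histories n).
Proof.
elim: n => // n IH; apply: allpairs_uniq => //; first exact: steps_uniq.
by move=> [y x] [y' x'] _ _ [-> ->].
Qed.

Lemma nth_hist n w k : (0 < k <= n)%N -> nth 0 (hist n w) (n - k) = tstep k w.
Proof.
elim: n => [|n IH] /andP[k0]; first by rewrite leqNgt k0.
rewrite leq_eqVlt ltnS => /predU1P[->|kn]; first by rewrite subnn.
by rewrite subSn//= IH// k0.
Qed.

Lemma measurable_hist n x : measurable [set w | hist n w = x].
Proof.
elim: n x => [|n IH] [|y x] /=.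
- by rewrite (_ : [set _ | _] = setT)//; apply/seteqP; split.
- by rewrite (_ : [set _ | _] = set0)//; apply/seteqP; split.
- by rewrite (_ : [set _ | _] = set0)//; apply/seteqP; split.
rewrite (_ : [set _ | _] = tstep n.+1 @^-1` [set y] `&` [set w | hist n w = x]).
  apply: measurableI => //; rewrite -[_ @^-1` _]setTI.
  by apply: measurable_tstep.
by apply/seteqP; split => w /=; [move=> [-> ->]|move=> [-> ->]].
Qed.

Lemma hist_sum n (G : seq R -> R) w : G (hist n w) =
  \sum_(x <- histories n) G x * \1_[set w | hist n w = x] w.
Proof.
rewrite (bigD1_seq (hist n w)) ?histories_uniq ?mem_histories ?hist_is_history//=.
rewrite indicE mem_set// mulr1 big1 ?addr0// => x /eqP xw.
by rewrite indicE memNset ?mulr0// => /= /esym.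
Qed.

Lemma measurable_comp_hist n (G : seq R -> R) : measurable_fun setT (fun w => G (hist n w)).
Proof.
rewrite (funext (hist_sum n G)).
by apply: measurable_simple => x; exact: measurable_hist.
Qed.


Lemma measurable_history_event n (x : nat -> R) : measurable (history_event X n x).
Proof.
rewrite (_ : history_event X n x =
    \bigcap_i (if (1 <= i <= n)%N then [set w | X i w = x i] else setT)).
  by apply: bigcapT_measurable => i; case: ifP => // _; exact: measurable_level.
apply/seteqP; split => [w xw i _|w xw i i1].
  by case: ifP => // i1; exact: xw.
by have := xw i I; rewrite i1.
Qed.

Lemma ae_hist_event n x : size x = n ->
  {ae P, forall w, history_event X n (fun i => nth 0 x (n - i)) w <-> hist n w = x}.
Proof.
move=> sx; apply: filterS ae_tstepE => w Xw; split => [xw|xw i /andP[i1 i2]].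
  apply: (@eq_from_nth _ 0); rewrite size_hist// => i iN.
  have h : (0 < n - i <= n)%N by rewrite subn_gt0 iN leq_subr.
  have := nth_hist w h; rewrite subKn ?(ltnW iN)// => ->.
  case/andP: (h) => h1 h2; rewrite Xw// (xw (n - i)%N)//.
  by rewrite subKn// ltnW.
by rewrite -Xw// -xw nth_hist// i1.
Qed.

(** Transfers the independence of the recalled index and of the action from
    prescribed values of X to values of [hist]. *)
Lemma probability_atom n x k a : (0 < n)%N -> size x = n -> (1 <= k <= n)%N ->
  P ([set w | hist n w = x] `&` [set w | K n w = k] `&` [set w | A n w = a]) =
  (P [set w | hist n w = x] * (n%:R^-1)%:E * P [set w | A n w = a])%E.
Proof.
move=> n0 sx kn; have E := ae_hist_event sx.
have mh := measurable_hist n x.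
have me := measurable_history_event n (fun i => nth 0 x (n - i)).
have mK := measurable_level_index n k; have mA := measurable_level_action n a.
rewrite -(erws_index hX kn) -(measure_ae_eq me mh E) -(erws_indep hX _ _ _ n0).
apply: measure_ae_eq.
- by apply: measurableI => //; exact: measurableI.
- by apply: measurableI => //; exact: measurableI.
by apply: filterS E => w E /=; rewrite /setI/= E.
Qed.

Lemma expectation_hist n G :
  ('E_P[fun w => G (hist n w)] =
   (\sum_(x <- histories n) G x * fine (P [set w | hist n w = x]))%R%:E)%E.
Proof.
apply: expectation_ae_simple; first exact: measurable_comp_hist.
  by move=> x; exact: measurable_hist.
by apply: aeW => w; exact: hist_sum.
Qed.

(** The history at time n + 1 is determined almost surely by the history at time
    n, the recalled index and the action; summing over these atoms and using
    independence gives the forecast. *)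
Lemma expectation_forecast n G : (0 < n)%N ->
  ('E_P[fun w => G (hist n.+1 w)] = 'E_P[fun w => forecast p q r G (hist n w)])%E.
Proof.
move=> n0; rewrite [RHS]expectation_hist.
pose ks := [seq (k, a) | k <- index_iota 1 n.+1, a <- [:: 1; -1; 0 : R]].
pose l := [seq (x, ka) | x <- histories n, ka <- ks].
pose B (i : seq R * (nat * R)) := [set w | hist n w = i.1] `&`
  [set w | K n w = i.2.1] `&` [set w | A n w = i.2.2].
pose c (i : seq R * (nat * R)) := G (i.2.2 * nth 0 i.1 (n - i.2.1) :: i.1).
have uks : uniq ks.
  apply: allpairs_uniq; [exact: iota_uniq|exact: steps_uniq|].
  by move=> [? ?] [? ?] _ _ [-> ->].
have ul : uniq l.
  apply: allpairs_uniq; [exact: histories_uniq|exact: uks|].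
  by move=> [? ?] [? ?] _ _ [-> ->].
rewrite (@expectation_ae_simple _ _ _ _ _ l c B); first last.
- have Hs := erws_step hX n0.
  apply: filterS3 ae_tstepE (filterI (ae_action n0) (ae_index n0)) Hs.
  move=> w Xw [Aw Kw] Xn.
  pose i0 := (hist n w, (K n w, A n w)).
  have il : i0 \in l.
    apply/allpairsP; exists i0; split => //=.
      by rewrite mem_histories hist_is_history.
    by apply/allpairsP; exists (K n w, A n w).
  rewrite (bigD1_seq i0)//= indicE mem_set// mulr1 big1 ?addr0.
    move: Kw; rewrite mem_index_iota ltnS => Kw.
    rewrite /c/= nth_hist// Xw// Xn Xw//.
    by case/andP: Kw.
  move=> [x [k a]] /eqP H; rewrite indicE memNset ?mulr0// => -[[/= hx hk] ha].
  by apply: H; rewrite -hx -hk -ha.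
- move=> i; apply: measurableI; last exact: measurable_level_action.
  by apply: measurableI; [exact: measurable_hist|exact: measurable_level_index].
- exact: measurable_comp_hist.
congr (_%:E); rewrite big_allpairs; apply: eq_big_seq => x xh.
have sx : size x = n by move: xh; rewrite mem_histories => /andP[/eqP].
set Px := fine _.
rewrite big_allpairs /forecast sx [X in _ = _ * X * _](big_nth 0) sx.
rewrite [X in _ = _ * X * _]big_nat_rev/= add0n big_add1/= mulr_sumr mulr_suml big_nat [RHS]big_nat.
apply: eq_bigr => k /andP[_ kn].
have Pa a : fine (P (B (x, (k.+1, a)))) =
    Px * n%:R^-1 * fine (P [set w | A n w = a]).
  rewrite /B/= probability_atom//.
  rewrite (probability_EFin _ (measurable_hist n x)).
  by rewrite (probability_EFin _ (measurable_level_action n a)).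
rewrite !big_cons big_nil !Pa /c/= (erws_repeat hX)// (erws_reverse hX)//.
rewrite (erws_stop hX)//= mul1r mulN1r mul0r; ring.
Qed.

Theorem expectation_mean n G : (0 < n)%N ->
  ('E_P[fun w => G (hist n w)] = (mean p q r s n G)%:E)%E.
Proof.
elim: n G => // n IH G _; have [->|n0] := posnP n; last first.
  by rewrite expectation_forecast// IH// meanS.
rewrite (@expectation_ae_simple _ _ _ _ _ [:: 1; -1 : R] (fun y => G [:: y])
  (fun y => [set w | X 1%N w = y])); first last.
- apply: filterS2 ae_tstepE ae_first => w /(_ 1%N isT) Xw.
  rewrite /= Xw !inE big_cons big_seq1 !indicE.
  have := steps_uniq; rewrite /= !inE !negb_or andbT => /andP[/andP[h _] _].
  move=> /orP[] /eqP H; rewrite H.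
    by rewrite mem_set// memNset/= ?H ?mulr1 ?mulr0 ?addr0//; apply/eqP.
  by rewrite memNset/= ?H ?mem_set ?mulr1 ?mulr0 ?add0r//; apply/eqP; rewrite eq_sym.
- by move=> y; exact: measurable_level.
- exact: measurable_comp_hist.
rewrite big_cons big_seq1 (erws_first_pos hX) (erws_first_neg hX)/=.
by congr (_%:E); ring.
Qed.

End bridge.

(** * Almost sure limits from polynomial moment rates *)

Section rate.
Context {d : measure_display} {T : measurableType d} {R : realType}.
Variable P : probability T R.
Implicit Types f g h : T -> R.

(** Bounding by a combination of two functions of known expectation is the only
    comparison needed below; taking one of them constant gives Young-type
    interpolations between moments. *)
Lemma expectation_le_lin f g h (a b G H : R) :
  measurable_fun setT f -> measurable_fun setT g -> measurable_fun setT h ->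
  0 <= a -> 0 <= b -> (forall w, 0 <= f w) -> (forall w, 0 <= g w) -> (forall w, 0 <= h w) ->
  (forall w, f w <= a * g w + b * h w) ->
  ('E_P[g] <= G%:E)%E -> ('E_P[h] <= H%:E)%E ->
  ('E_P[f] <= (a * G + b * H)%:E)%E.
Proof.
rewrite unlock => mf mg mh a0 b0 f0 g0 h0 fgh EG EH.
have mag : measurable_fun setT (fun w => (a * g w)%:E).
  by apply/measurable_EFinP; exact: measurable_funM.
have mbh : measurable_fun setT (fun w => (b * h w)%:E).
  by apply/measurable_EFinP; exact: measurable_funM.
apply: (@le_trans _ _ (\int[P]_w ((a * g w)%:E + (b * h w)%:E))%E).
  apply: ge0_le_integral => //.
  - by move=> w _; rewrite lee_fin.
  - exact/measurable_EFinP.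
  - exact: emeasurable_funD.
  - by move=> w _; rewrite lee_fin fgh.
rewrite ge0_integralD//; [|by move=> w _; rewrite lee_fin mulr_ge0..].
under eq_integral do rewrite EFinM.
under [X in (_ + X)%E]eq_integral do rewrite EFinM.
rewrite !ge0_integralZl_EFin//; [|by move=> w _; rewrite lee_fin|exact/measurable_EFinP
  |by move=> w _; rewrite lee_fin|exact/measurable_EFinP].
by rewrite EFinD !EFinM leeD// lee_wpmul2l// lee_fin.
Qed.

Lemma expectation_le_const f (a : R) : 0 <= a ->
  measurable_fun setT f -> (forall w, 0 <= f w <= a) -> ('E_P[f] <= a%:E)%E.
Proof.
move=> a0 mf f0a.
rewrite -[a]mulr1 -[a * 1]addr0 -[X in (_ + X)%:E](mul0r 1).
apply: (@expectation_le_lin _ (cst 1) (cst 1)) => //.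
- by move=> w; case/andP: (f0a w).
- by move=> w; rewrite /cst mulr1 mul0r addr0; case/andP: (f0a w).
- by rewrite expectation_cst.
- by rewrite expectation_cst.
Qed.

(** Monotone convergence: a series of nonnegative functions with summable
    expectations has an integrable, hence almost everywhere finite, sum. *)
Lemma ae_cvg_series (f : nat -> T -> R) (u : nat -> R) (B : R) :
  (forall n, measurable_fun setT (f n)) -> (forall n w, 0 <= f n w) ->
  (forall n, ('E_P[f n] <= (u n)%:E)%E) -> (forall n, series u n <= B) ->
  {ae P, forall w, cvgn (series (fun n => f n w))}.
Proof.
move=> mf f0 Ef uB.
pose F w : \bar R := (\sum_(n <oo) (f n w)%:E)%E.
have mF : measurable_fun setT F.
  apply: ge0_emeasurable_sum => [k w _ _|k _]; first by rewrite lee_fin.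
  exact/measurable_EFinP.
have F0 w : (0 <= F w)%E by apply: nneseries_ge0 => k _ _; rewrite lee_fin.
have IF : P.-integrable setT F.
  apply/integrableP; split => //.
  under eq_integral do rewrite gee0_abs//.
  rewrite /F integral_nneseries//; last 2 first.
  - by move=> n; exact/measurable_EFinP.
  - by move=> n w _; rewrite lee_fin.
  apply: (@le_lt_trans _ _ B%:E); last exact: ltry.
  apply: lime_le.
    apply: is_cvg_nneseries => n _ _; apply: integral_ge0 => w _.
    by rewrite lee_fin.
  apply: nearW => n; apply: (@le_trans _ _ (\sum_(0 <= i < n) (u i)%:E)%E).
    by apply: lee_sum => i _; have := Ef i; rewrite unlock.
  by rewrite sumEFin lee_fin; exact: uB.
apply: filterS (integrable_ae measurableT IF) => w /(_ I) Fw.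
apply: nondecreasing_is_cvgn; first by apply: nondecreasing_series => n _ _.
exists (fine (F w)) => _ [n _ <-].
rewrite -lee_fin fineK// /series/= -sumEFin.
by apply: nneseries_lim_ge => i _ _; rewrite lee_fin.
Qed.

Lemma cvg_of_cvg_even_pow (u : nat -> R) m : (0 < m)%N ->
  (u n ^+ m.*2 @[n --> \oo] --> 0) -> u n @[n --> \oo] --> 0.
Proof.
move=> m0 /cvgrPdist_lt um; apply/cvgrPdist_lt => e e0.
have em : 0 < e ^+ m.*2 by rewrite exprn_gt0.
near=> n; rewrite sub0r normrN ltNge; apply/negP => eu.
have : `|0 - u n ^+ m.*2| < e ^+ m.*2 by near: n; exact: um.
rewrite sub0r normrN normrX ltNge => /negP; apply.
by rewrite lerXn2r// nnegrE ?ltW.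
Unshelve. all: by end_near. Qed.

Variables (M : nat -> T -> R) (delta : R).
Hypothesis mM : forall n, measurable_fun setT (M n).
Hypothesis delta0 : 0 < delta.
Hypothesis rateM : forall k, exists2 C : R, 0 <= C & forall N n, (0 < N)%N -> (N <= n)%N ->
  ('E_P[fun w => ((M n w - M N w) ^+ (k.+1).*2)%R] <= (C * (N%:R `^ (- delta)) ^+ k.+1)%:E)%E.

(** At N = 2^j the rate for squares is a geometric sequence rho^(2j), and
    |y| <= rho^j + y^2 / rho^j makes the absolute increments summable in mean. *)
Lemma ae_cvg_dyadic : {ae P, forall w, cvgn (fun j => M (2 ^ j) w)}.
Proof.
have [C C0 HC] := rateM 0.
(* rho ^ (2j) is the rate N ^ (- delta) at N = 2 ^ j. *)
pose rho : R := 2 `^ (- (delta / 2)).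
have rho0 : 0 < rho by rewrite powR_gt0.
have rho1 : rho < 1.
  rewrite /rho powRN invf_lt1 ?powR_gt0//.
  have := @gt0_ltr_powR R (delta / 2) _ 1 2; rewrite powR1; apply.
  - by rewrite divr_gt0.
  - by rewrite nnegrE.
  - by rewrite nnegrE.
  - by rewrite ltr1n.
pose f j w := `|M (2 ^ j.+1) w - M (2 ^ j) w|.
have mf j : measurable_fun setT (f j).
  by apply: measurableT_comp => //; apply: measurable_funB.
have Ef j : ('E_P[f j] <= ((1 + C) * rho ^+ j)%:E)%E.
  have rj0 : 0 < rho ^+ j by rewrite exprn_gt0.
  have n0 : (0 < 2 ^ j)%N by rewrite expn_gt0.
  have nn : (2 ^ j <= 2 ^ j.+1)%N by rewrite leq_exp2l.
  have E1 : ('E_P[fun w => ((M (2 ^ j.+1) w - M (2 ^ j) w) ^+ 2)%R] <=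
      (C * (2 ^ j)%:R `^ (- delta))%:E)%E by exact: HC n0 nn.
  have -> : (1 + C) * rho ^+ j = rho ^+ j * 1 + rho ^- j * (C * ((2 ^ j)%:R `^ (- delta))).
    have -> : ((2 ^ j)%:R `^ (- delta)) = rho ^+ j * rho ^+ j.
      rewrite natrX -powR_mulrn// -powRrM -expr2 -exprM.
      rewrite -[RHS]powR_mulrn ?powR_ge0// -powRrM; congr (_ `^ _).
      by rewrite natrM; field.
    by field; rewrite gt_eqF.
  apply: (expectation_le_lin (g := cst 1) _ _ _ _ _ _ _ _ _ _ E1) => //.
  - by apply: measurable_funX; apply: measurable_funB.
  - exact: ltW.
  - by rewrite invr_ge0 ltW.
  - by move=> w; exact: normr_ge0.
  - by move=> w; exact: sqr_ge0.
  - move=> w; rewrite /f /cst mulr1; set y := _ - _.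
    rewrite -(ler_pM2l rj0) mulrDr mulrA mulfV ?gt_eqF// mul1r.
    rewrite -[y ^+ _]real_normK ?num_real//.
    have := normr_ge0 y; have := sqr_ge0 (`|y| - rho ^+ j); nra.
  - by rewrite expectation_cst.
have ub n : series (fun j => (1 + C) * rho ^+ j) n <= (1 + C) / (1 - rho).
  have -> : (fun j => (1 + C) * rho ^+ j) = geometric (1 + C) rho by [].
  rewrite geometric_seriesE ?lt_eqF//=.
  rewrite ler_wpM2r ?invr_ge0 ?subr_ge0 ?(ltW rho1)//.
  by rewrite ler_piMr ?addr_ge0// gerBl exprn_ge0// ltW.
have := ae_cvg_series mf (fun _ _ => normr_ge0 _) Ef ub.
apply: filterS => w /(@normed_cvg _ R^o) cw.
have -> : (fun j => M (2 ^ j) w) =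
    (fun j => M 1%N w + series (fun j => M (2 ^ j.+1) w - M (2 ^ j) w) j).
  apply/funext => j; rewrite seriesEnat/=.
  by rewrite (telescope_sumr (fun j => M (2 ^ j) w))//= subrKC.
by apply: is_cvgD => //; exact: is_cvg_cst.
Qed.

(** A limit superior is measurable without knowing where the sequence
    converges. *)
Definition dyadic_lim (w : T) : R := fine (limn_esup (fun j => (M (2 ^ j) w)%:E)).

Lemma measurable_dyadic_lim : measurable_fun setT dyadic_lim.
Proof.
apply: measurableT_comp => //.
by apply: measurable_fun_limn_esup => n; apply/measurable_EFinP.
Qed.

Lemma ae_cvg_dyadic_lim : {ae P, forall w, M (2 ^ j) w @[j --> \oo] --> dyadic_lim w}.
Proof.
apply: filterS ae_cvg_dyadic => w cw.
have cE : (fun j => (M (2 ^ j) w)%:E) @ \oo --> (limn (fun j => M (2 ^ j) w))%:E.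
  by apply: cvg_EFin => //; apply: nearW.
rewrite /dyadic_lim is_cvg_limn_esupE; last by apply/cvg_ex; eexists; exact: cE.
by rewrite (cvg_lim _ cE).
Qed.

(** Fatou's lemma along the times 2^(j + N), which are all at least N. *)
Lemma rate_dyadic_lim k : exists2 C : R, 0 <= C & forall N, (0 < N)%N ->
  ('E_P[fun w => ((dyadic_lim w - M N w) ^+ (k.+1).*2)%R] <= (C * (N%:R `^ (- delta)) ^+ k.+1)%:E)%E.
Proof.
have [C C0 HC] := rateM k; exists C => // N N0.
set m := (k.+1).*2.
pose f j w := ((M (2 ^ (j + N)) w - M N w) ^+ m)%:E.
have mf j : measurable_fun setT (f j).
  by apply/measurable_EFinP; apply: measurable_funX; exact: measurable_funB.
have f0 j w : (0 <= f j w)%E by rewrite lee_fin exprn_even_ge0// odd_double.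
rewrite unlock.
rewrite (ae_eq_integral (fun w => limn_einf (f ^~ w)))//; first last.
- apply: filterS ae_cvg_dyadic_lim => w cw _.
  have cf : f ^~ w @ \oo --> ((dyadic_lim w - M N w) ^+ m)%:E.
    apply: cvg_EFin; first exact: nearW.
    rewrite /comp/=.
    have h : M (2 ^ (j + N))%N w - M N w @[j --> \oo] --> dyadic_lim w - M N w.
      by apply: cvgB; [rewrite -(cvg_shiftn N) in cw|exact: cvg_cst].
    by apply: (cvg_comp _ (fun x => x ^+ m) h); exact: exprn_continuous.
  by rewrite (is_cvg_limn_einfE) ?(cvg_lim _ cf)//; apply/cvg_ex; eexists; exact: cf.
- apply: (measurableT_comp (f := -%E)) => //.
  apply: measurable_fun_limn_esup => j.
  exact: (measurableT_comp (f := -%E)).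
- by apply/measurable_EFinP; apply: measurable_funX; apply: measurable_funB => //; exact: measurable_dyadic_lim.
apply: (le_trans (fatou _ _ _ _)) => //.
rewrite limn_einf_lim; apply: lime_le; first exact: is_cvg_einfs.
apply: nearW => n; apply: (@le_trans _ _ (\int[P]_w f n w)%E).
  by apply: ereal_inf_lbound; exists n => /=.
have := HC N (2 ^ (n + N))%N N0; rewrite unlock; apply.
by rewrite (leq_trans (ltnW (ltn_expl N (ltnSn 1))))// leq_exp2l// leq_addl.
Qed.

(** For k + 1 >= 2 / delta the moments of order 2(k + 1) of the errors are
    bounded by a multiple of N^(-2), so the powers of the errors are almost
    surely summable and tend to 0. *)
Lemma ae_cvg_of_rate : {ae P, forall w, M n w @[n --> \oo] --> dyadic_lim w}.
Proof.
pose k := Num.bound (2 / delta); have k0 : 2 <= k.+1%:R * delta.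
  rewrite -ler_pdivrMr// ltW// (lt_le_trans (archi_boundP _))//.
    by rewrite divr_ge0// ltW.
  by rewrite ler_nat.
have [C C0 HC] := rate_dyadic_lim k; set m := (k.+1).*2.
pose f n w := (dyadic_lim w - M n.+1 w) ^+ m.
have mf n : measurable_fun setT (f n).
  by apply: measurable_funX; apply: measurable_funB => //; exact: measurable_dyadic_lim.
have f0 n w : 0 <= f n w by rewrite exprn_even_ge0// odd_double.
have Ef n : ('E_P[f n] <= (C * n.+1%:R `^ (- 1 - 1))%:E)%E.
  apply: (le_trans (HC n.+1 _)) => //; rewrite lee_fin ler_wpM2l//.
  rewrite -powR_mulrn ?powR_ge0// -powRrM ler_powR ?ler1n//.
  by rewrite mulNr mulrC; lra.
have ub n : series (fun n => C * n.+1%:R `^ (- 1 - 1)) n <= C * ((2 + 1) / 1 * 1%:R `^ (- 1)).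
  rewrite seriesEnat/= -mulr_sumr ler_wpM2l//.
  rewrite -(big_add1 _ _ 0%N n.+1 xpredT (fun i => i%:R `^ (- 1 - 1))).
  exact: sum_powR_le.
apply: filterS (ae_cvg_series mf f0 Ef ub) => w cw.
have := cvg_series_cvg_0 cw => c0.
have h : dyadic_lim w - M n.+1 w @[n --> \oo] --> 0.
  exact: (@cvg_of_cvg_even_pow _ k.+1).
have g : dyadic_lim w - (dyadic_lim w - M n.+1 w) @[n --> \oo] --> dyadic_lim w - 0.
  by apply: cvgB => //; exact: cvg_cst.
rewrite -cvg_shiftS; rewrite subr0 in g.
rewrite (_ : (fun n => _) = (fun n => M n.+1 w)) in g; first exact: g.
by apply/funext => n; rewrite subKr.
Qed.

End rate.

(** * The superdiffusive limit *)

Section limits.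
Context {d : measure_display} {T : measurableType d} {R : realType}.
Variable P : probability T R.
Variables (M : nat -> T -> R) (L : T -> R) (delta : R).
Hypotheses (mM : forall n, measurable_fun setT (M n)) (mL : measurable_fun setT L).
Hypothesis delta0 : 0 < delta.
Hypothesis rateL : forall k, exists2 C : R, 0 <= C & forall n, (0 < n)%N ->
  ('E_P[fun w => ((L w - M n w) ^+ (k.+1).*2)%R] <= (C * (n%:R `^ (- delta)) ^+ k.+1)%:E)%E.
Hypothesis M1 : forall w, `|M 1 w| <= 1.

(** Interpolation: |y|^m <= t + y^(2m) / t, where t is the target rate. *)
Lemma abs_rate m : (0 < m)%N -> exists2 C : R, 0 <= C & forall n, (0 < n)%N ->
  ('E_P[fun w => (`|M n w - L w| ^+ m)%R] <= (C * (n%:R `^ (- (delta / 2))) ^+ m)%:E)%E.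
Proof.
case: m => // k _; have [C C0 HC] := rateL k.
exists (1 + C); first by rewrite addr_ge0.
move=> n n0; have n0' : (0 : R) < n%:R by rewrite ltr0n.
set t := (n%:R `^ _) ^+ _; have t0 : 0 < t by rewrite exprn_gt0// powR_gt0.
have E1 := HC n n0.
have tt : (n%:R `^ (- delta)) ^+ k.+1 = t * t.
  rewrite /t -exprMn -powRD; last by rewrite (gt_eqF n0') implybT.
  by congr ((_ `^ _) ^+ _); rewrite -opprD -splitr.
rewrite (_ : (1 + C) * t = t * 1 + t^-1 * (C * (n%:R `^ (- delta)) ^+ k.+1)); last first.
  by rewrite tt; field; rewrite gt_eqF.
apply: (expectation_le_lin (g := cst 1) _ _ _ _ _ _ _ _ _ _ E1) => //.
- apply: measurable_funX; apply: measurableT_comp => //.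
  exact: measurable_funB.
- by apply: measurable_funX; exact: measurable_funB.
- exact: ltW.
- by rewrite invr_ge0 ltW.
- by move=> w; rewrite exprn_even_ge0// odd_double.
- move=> w; rewrite /cst mulr1 -normrN opprB; set y := L w - M n w.
  rewrite -(ler_pM2l t0) mulrDr mulrA mulfV ?gt_eqF// mul1r.
  rewrite -mul2n mulnC exprM -[y ^+ k.+1 ^+ 2]real_normK ?num_real// normrX.
  set z := `|y| ^+ k.+1; have z0 : 0 <= z by rewrite exprn_ge0.
  have := sqr_ge0 (z - t); nra.
- by rewrite expectation_cst.
Qed.

Lemma abs_moment_bound m : (0 < m)%N -> exists2 C : R, 0 <= C &
  ('E_P[fun w => (`|L w| ^+ m)%R] <= C%:E)%E.
Proof.
move=> m0; have [C C0 /(_ 1%N isT) HC] := abs_rate m0.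
rewrite powR1 expr1n mulr1 in HC.
exists (2 ^+ m * C + 2 ^+ m * 1); first by rewrite addr_ge0// mulr_ge0// exprn_ge0.
have E2 : ('E_P[fun w => (`|M 1 w| ^+ m)%R] <= 1%:E)%E.
  apply: expectation_le_const => //; last by move=> w; rewrite exprn_ge0//= exprn_ile1.
  by apply: measurable_funX; exact: measurableT_comp.
apply: (expectation_le_lin _ _ _ _ _ _ _ _ _ HC E2) => //; rewrite ?exprn_ge0//.
- by apply: measurable_funX; exact: measurableT_comp.
- by apply: measurable_funX; apply: measurableT_comp => //; exact: measurable_funB.
- by apply: measurable_funX; exact: measurableT_comp.
move=> w; rewrite -mulrDr; apply: (le_trans _ (exprD_le_max _ _ _)) => //.
rewrite lerXn2r ?nnegrE ?addr_ge0// -[L w](subrK (M 1%N w)) (le_trans (ler_normD _ _))//.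
by rewrite lerD2r distrC subrK.
Qed.

(** Splits u n * M n - c * L as u n * (M n - L) + (u n - c) * L. *)
Lemma scaled_cvg_moment (u : nat -> R) (c : R) m : (0 < m)%N -> (forall n, 0 <= u n) ->
  u n @[n --> \oo] --> c ->
  ('E_P[fun w => (`|u n * M n w - c * L w| ^+ m)%R] @[n --> \oo] --> 0)%E.
Proof.
move=> m0 u0 uc.
have [C C0 HC] := abs_rate m0; have [B B0 HB] := abs_moment_bound m0.
pose v n := 2 ^+ m * (u n) ^+ m * (C * (n%:R `^ (- (delta / 2))) ^+ m) + 2 ^+ m * `|u n - c| ^+ m * B.
have ve n : (0 < n)%N -> ('E_P[fun w => (`|u n * M n w - c * L w| ^+ m)%R] <= (v n)%:E)%E.
  move=> n0; have En := HC n n0.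
  apply: (expectation_le_lin _ _ _ _ _ _ _ _ _ En HB) => //.
  - apply: measurable_funX; apply: measurableT_comp => //.
    by apply: measurable_funB; apply: measurable_funM.
  - by apply: measurable_funX; apply: measurableT_comp => //; exact: measurable_funB.
  - by apply: measurable_funX; exact: measurableT_comp.
  - by rewrite mulr_ge0// exprn_ge0.
  move=> w; rewrite -!mulrA -mulrDr -!exprMn.
  apply: (le_trans _ (exprD_le_max _ _ _)); rewrite ?mulr_ge0//.
  rewrite lerXn2r ?nnegrE ?addr_ge0 ?mulr_ge0//.
  rewrite -{2}(ger0_norm (u0 n)) -!normrM.
  rewrite (_ : u n * M n w - c * L w = u n * (M n w - L w) + (u n - c) * L w) ?ler_normD//.
  by ring.
have v0 : v n @[n --> \oo] --> 0.
  have pw (f : nat -> R) (l : R) : f n @[n --> \oo] --> l -> f n ^+ m @[n --> \oo] --> l ^+ m.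
    by move=> fl; apply: (cvg_comp _ (fun x => x ^+ m) fl); exact: exprn_continuous.
  have t0 : (n%:R `^ (- (delta / 2))) ^+ m @[n --> \oo] --> (0 : R).
    have := @powRN_cvg0 R (delta / 2) (divr_gt0 delta0 (ltr0Sn _ _)) => /pw.
    by rewrite expr0n -[m == 0%N]negbK -lt0n m0.
  have c0 : `|u n - c| ^+ m @[n --> \oo] --> (0 : R).
    have : `|u n - c| @[n --> \oo] --> `|c - c|.
      by apply: cvg_norm; apply: cvgB => //; exact: cvg_cst.
    by rewrite subrr normr0 => /pw; rewrite expr0n -[m == 0%N]negbK -lt0n m0.
  have -> : 0 = 2 ^+ m * c ^+ m * (C * 0) + 2 ^+ m * 0 * B :> R by ring.
  apply: cvgD; apply: cvgM; (try exact: cvg_cst); apply: cvgM => //; (try exact: cvg_cst).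
  exact: pw.
apply: (@squeeze_cvge _ _ _ _ (cst 0%E) _ (fun n => (v n)%:E)).
- near=> n; rewrite /cst expectation_ge0/=; last by move=> w; rewrite exprn_ge0.
  by apply: ve; near: n; exists 1%N.
- exact: cvg_cst.
- by apply: cvg_EFin; [exact: nearW|exact: v0].
Unshelve. all: by end_near. Qed.

End limits.

Lemma drop_hist d (T : measurableType d) (R : realType) (P : probability T R)
    (X : nat -> {RV P >-> R}) N n w : (N <= n)%N ->
  drop (n - N) (hist (X := X) n w) = hist (X := X) N w.
Proof.
elim: n => [|n IH]; first by rewrite leqn0 => /eqP ->.
rewrite leq_eqVlt => /predU1P[->|Nn]; first by rewrite subnn drop0.
by rewrite subSn//= IH.
Qed.

Lemma position_hist d (T : measurableType d) (R : realType) (P : probability T R)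
    (X : nat -> {RV P >-> R}) n w :
  (forall k, (0 < k)%N -> tstep (X := X) k w = X k w) ->
  position X n w = pos (hist (X := X) n w).
Proof.
move=> Xw; elim: n => [|n IH]; first by rewrite /position big_geq// /pos big_nil.
by rewrite /position big_nat_recr//= -/(position X n w) IH pos_cons Xw// addrC.
Qed.

Theorem theorem3p7 (d : measure_display) (T : measurableType d) (R : realType)
    (P : probability T R) (p q r s : R)
    (X : nat -> {RV P >-> R}) (K : nat -> {RV P >-> nat})
    (A : nat -> {RV P >-> R})
    (hp : 0 <= p <= 1) (hq : 0 <= q <= 1) (hr : 0 < r < 1)
    (hpqr : p + q + r = 1) (hs : 0 <= s <= 1)
    (hX : is_erws p q r s X K A)
    (hsuper : 3 / 4 < p / (1 - r)) :
  exists L : {RV P >-> R},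
    [/\ non_degenerate P L,
        {ae P, forall w,
          (fun n : nat => position X n w / n%:R `^ (2 * p + r - 1)) @ \oo
            --> L w} &
        forall m : nat, (1 <= m)%N ->
          (fun n : nat => ('E_P[(fun w : T =>
             `|position X n w / n%:R `^ (2 * p + r - 1) - L w| ^+ m)%R])%E) @ \oo
            --> 0%E].
Proof.
have -> : 2 * p + r - 1 = p - q by lra.
have delta0 : 0 < 2 * (p - q) - (p + q).
  case/andP: hr => r0 r1; move: hsuper; rewrite ltr_pdivlMr ?subr_gt0//.
  by move=> ?; lra.
have q0 : 0 <= q by case/andP: hq.
have alpha01 : 0 <= p - q <= 1.
  by case/andP: hp => _ p1; apply/andP; split; lra.
have alpha0 : 0 <= p - q by case/andP: alpha01.
pose h n w := hist (X := X) n w.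
pose M n w := mart p q (h n w).
have EM n G : (0 < n)%N -> ('E_P[fun w => G (h n w)] = (mean p q r s n G)%:E)%E.
  exact: (expectation_mean hpqr hX).
have mM n : measurable_fun setT (M n) by exact: measurable_comp_hist.
have rateM k : exists2 C : R, 0 <= C & forall N n, (0 < N)%N -> (N <= n)%N ->
    ('E_P[fun w => ((M n w - M N w) ^+ (k.+1).*2)%R] <=
     (C * (N%:R `^ (- (2 * (p - q) - (p + q)))) ^+ k.+1)%:E)%E.
  have [C C0 HC] := mean_mart_diff_exp hp hq hr hpqr hs alpha0 delta0 k.
  exists C => // N n N0 Nn; have n0 : (0 < n)%N by exact: leq_trans Nn.
  rewrite (_ : (fun w => _) = (fun w => mart_diff p q N (h n w) ^+ (k.+1).*2)).
    by rewrite (EM n (fun x => mart_diff p q N x ^+ (k.+1).*2))// lee_fin HC.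
  by apply/funext => w; rewrite /mart_diff /h size_hist drop_hist.
pose L0 := dyadic_lim M; have mL0 : measurable_fun setT L0 by exact: measurable_dyadic_lim.
have rateL := rate_dyadic_lim mM delta0 rateM.
have ML := ae_cvg_of_rate mM delta0 rateM.
have M1 w : `|M 1%N w| <= 1.
  rewrite /M /mart size_hist growth1 divr1.
  exact: (norm_pos_le (hist_is_history 1 w)).
have [c c1 uc] := growth_ratio_cvg alpha01.
pose u n : R := growth (p - q) n / n%:R `^ (p - q).
have u0 n : 0 <= u n by rewrite divr_ge0 ?powR_ge0// ltW// growth_gt0.
have Xae := ae_tstepE hpqr hX.
have SM : {ae P, forall w, forall n, position X n w / n%:R `^ (p - q) = u n * M n w}.
  apply: filterS Xae => w Xw n; rewrite (position_hist _ Xw).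
  rewrite /M /mart size_hist /u mulrAC mulrCA mulfV ?mulr1 -/(h n w) //.
  by rewrite gt_eqF// growth_gt0.
pose Lf w := c * L0 w.
have mLf : measurable_fun setT Lf by exact: measurable_funM.
pose L : {RV P >-> R} := HB.pack Lf (isMeasurableFun.Build _ _ _ _ Lf mLf).
exists L; split.
(* If L = a almost surely, then M converges to a / c in mean square. *)
- move=> [a La]; have c0 : c != 0 by rewrite gt_eqF// (lt_le_trans ltr01).
  have [C C0 HC] := rateL 0%N.
  set v := (p + q - (p - q) ^+ 2) / growth (p - q) 2 ^+ 2.
  have v0 : 0 < v by rewrite divr_gt0 ?exprn_gt0 ?growth_gt0// subr_gt0 (drift_sqr_lt hq hr hpqr).
  have vn n : (2 <= n)%N -> v <= C * n%:R `^ (- (2 * (p - q) - (p + q))).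
    move=> n2; have n0 : (0 < n)%N by exact: leq_trans n2.
    have := mean_mart_sqr_ge hp hq hr hpqr hs alpha0 (a / c) n2 => /le_trans; apply.
    have H := HC n n0; rewrite expr1 in H.
    rewrite -lee_fin -EM//; apply: (le_trans _ H).
    rewrite !unlock le_eqVlt; apply/orP; left; apply/eqP; apply: ae_eq_integral => //.
    + apply/measurable_EFinP; apply: measurable_funX.
      by apply: measurable_funB; [exact: (mM n)|exact: measurable_cst].
    + by apply/measurable_EFinP; apply: measurable_funX; exact: measurable_funB.
    apply: filterS La => w Lw _; congr (_%:E).
    have -> : dyadic_lim M w = a / c by rewrite -Lw /Lf/= /Lf mulrC mulKf.
    by rewrite -/(M n w) -sqrrN opprB.
  have cv : C * n%:R `^ (- (2 * (p - q) - (p + q))) @[n --> \oo] --> C * 0.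
    by apply: cvgM; [exact: cvg_cst|exact: powRN_cvg0].
  have : v <= C * 0.
    rewrite -(cvg_lim _ cv)//; apply: limr_ge; first by apply/cvg_ex; eexists; exact: cv.
    by near=> n; apply: vn; near: n; exists 2%N.
  by rewrite mulr0 leNgt v0.
- apply: filterS2 SM ML => w Sw Mw.
  by rewrite (funext Sw); exact: cvgM.
- move=> m m0.
  have H := scaled_cvg_moment mM mL0 delta0 rateL M1 m0 u0 uc.
  rewrite (_ : (fun n : nat => _) = (fun n => 'E_P[fun w => (`|u n * M n w - c * L0 w| ^+ m)%R])%E) //.
  apply/funext => n; rewrite unlock; apply: ae_eq_integral => //.
  + apply/measurable_EFinP; apply: measurable_funX; apply: measurableT_comp => //.
    apply: measurable_funB => //; apply: measurable_funM => //.
    by rewrite /position; apply: measurable_sum => i; exact: measurable_funPT.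
  + apply/measurable_EFinP; apply: measurable_funX; apply: measurableT_comp => //.
    by apply: measurable_funB; apply: measurable_funM.
  by apply: filterS SM => w Sw _; rewrite Sw.
Unshelve. all: by end_near. Qed.
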